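(* Let $k\ge 4$ be an even integer, let $i=\frac k2$, and let $\eta=\sum_{j=0}^{k/2}(-1)^jv^{\frac k2,j}\in\overline{L(k,\frac k2)}$. Then the vector $(e-f)_{-\frac12}\eta$ is another lowest weight vector, besides $\eta$, for the parafermion vertex operator algebra $K_0$ in the $\sigma$-twisted module $\overline{L(k,\frac k2)}$.
   Context: Algebras. $\{h,e,f\}$ is the standard Chevalley basis of $sl_2$: $[h,e]=2e$, $[h,f]=-2f$, $[e,f]=h$; $a(n)=a\otimes t^n$ in the affine Lie algebra $\widehat{sl}_2$. $L(k,0)$ is the simple affine vertex operator algebra of level $k$ of $\widehat{sl}_2$, and $L(k,i)$, $0\le i\le k$, are its irreducible modules. The top level of $L(k,i)$ is $U^i=\bigoplus_{j=0}^i\mathbb{C}v^{i,j}$, with $h(0)v^{i,j}=(i-2j)v^{i,j}$; $e(0)v^{i,0}=0$, $e(0)v^{i,j}=(i-j+1)v^{i,j-1}$ for $1\le j\le i$; $f(0)v^{i,i}=0$, $f(0)v^{i,j}=(j+1)v^{i,j+1}$ for $0\le j\le i-1$; and $a(n)v^{i,j}=0$ for $a\in\{h,e,f\}$, $n\ge1$. The parafermion vertex operator algebra is $K_0=\{v\in L(k,0)\mid h(m)v=0\ \forall m\ge0\}$, with Virasoro vector $\omega=\frac{1}{2k(k+2)}\big(-kh(-2)\mathbf 1-h(-1)^2\mathbf 1+2ke(-1)f(-1)\mathbf 1\big)$. Twisted modules. $\sigma$ is the automorphism of $L(k,0)$ induced by $\sigma(h)=-h$, $\sigma(e)=f$, $\sigma(f)=e$;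 it preserves $K_0$. Put $h''=\frac14(e+f)$ (identified with $h''(-1)\mathbf 1$), so $\sigma=e^{2\pi\sqrt{-1}h''(0)}$ on $L(k,0)$. Let $\Delta(h'',z)=z^{h''(0)}\exp\big(\sum_{m\ge1}\frac{h''(m)}{-m}(-z)^{-m}\big)$. The irreducible $\sigma$-twisted $L(k,0)$-module $\overline{L(k,i)}$ is the vector space $L(k,i)$ with $Y_\sigma(u,z)=Y(\Delta(h'',z)u,z)$, where $Y$ is the untwisted action; write $Y_\sigma(u,z)=\sum_nu_nz^{-n-1}$, where $n\in\mathbb Z$ if $\sigma(u)=u$ and $n\in\mathbb{Z}+\frac12$ if $\sigma(u)=-u$. An element $a\in sl_2$ is identified with $a(-1)\mathbf 1$, so $(e-f)_{-\frac12}$ is the coefficient of $z^{-\frac12}$ in $Y_\sigma((e-f)(-1)\mathbf 1,z)$. By restriction $\overline{L(k,i)}$ is a $\sigma$-twisted $K_0$-module. A lowest weight vector for $K_0$ is a nonzero eigenvector $w$ of $L(0)=\omega_1$ such that $u_mw=0$ for every homogeneous $u\in K_0$ and every $m>\mathrm{wt}\,u-1$. *)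

(* Defs.v *)
From mathcomp Require Import all_boot all_order all_algebra.
From mathcomp Require Import boolp classical_sets fsbigop reals.
From mathcomp Require Import complex.

Set Implicit Arguments.
Unset Strict Implicit.
Unset Printing Implicit Defensive.

Import Order.TTheory GRing.Theory Num.Theory.
Local Open Scope ring_scope.

Section LinearAlgebra.
Variables (C : fieldType) (V : lmodType C).

Definition subspace (W : set V) : Prop :=
  W 0 /\ forall a x y, W x -> W y -> W (a *: x + y).

Definition trivial_subspace (W : set V) : Prop :=
  (forall x, W x -> x = 0) \/ (forall x, W x).

(* The component of u in the s-eigenspace of T, for u a finite sum of
   eigenvectors of T; such a component is unique when T is linear. *)
Definition eigen_component (T : V -> V) (s : C) (u : V) : V :=
  xget 0 [set x | T x = s *: x /\
    exists (r : seq C) (y : C -> V),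
      [/\ s \notin r, forall t, T (y t) = t *: y t
        & u = x + \sum_(t <- r) y t]].

End LinearAlgebra.

Definition gbinom (C : fieldType) (x : C) (j : nat) : C :=
  (\prod_(i < j) (x - i%:R)) / (j`!)%:R.

(* Y u n is the mode u_n, i.e. Y(u,z) = \sum_n u_n z^(-n-1). *)
Section FieldAxioms.
Variables (C : fieldType) (V M : lmodType C).
Variables (Y : V -> int -> V -> V) (YM : V -> int -> M -> M).

Definition bilinear_modes : Prop :=
  (forall a u u' n w, YM (a *: u + u') n w = a *: YM u n w + YM u' n w) /\
  (forall a u n w w', YM u n (a *: w + w') = a *: YM u n w + YM u n w').

Definition truncated_modes : Prop :=
  forall u w, exists N : int, forall n : int, N <= n -> YM u n w = 0.

(* The Borcherds identity (equivalent to the Jacobi identity).  Its sums over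
   all j >= 0 are finite: they stop at any N beyond which the modes vanish. *)
Definition borcherds : Prop :=
  forall (u v : V) (w : M) (l m n : int) (N : nat),
    (forall j : nat, (N <= j)%N ->
      [/\ Y u (l + j%:Z) v = 0, YM u (m + j%:Z) w = 0
        & YM v (n + j%:Z) w = 0]) ->
    \sum_(j < N) gbinom (m%:~R : C) j *:
        YM (Y u (l + j%:Z) v) (m + n - j%:Z) w
    = \sum_(j < N) ((-1) ^+ j * gbinom (l%:~R : C) j) *:
        (YM u (l + m - j%:Z) (YM v (n + j%:Z) w)
         - (-1) ^ l *: YM v (l + n - j%:Z) (YM u (m + j%:Z) w)).

End FieldAxioms.

Record vertexAlgebra (C : fieldType) := VertexAlgebra {
  va_space :> lmodType C;
  va_mode : va_space -> int -> va_space -> va_space;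
  vacuum : va_space;
  va_bilinear : bilinear_modes va_mode;
  va_truncated : truncated_modes va_mode;
  va_vacuum : forall n u, va_mode vacuum n u = if n == -1 then u else 0;
  va_creation : forall u, va_mode u (-1) vacuum = u;
  va_creation0 : forall u (n : int), 0 <= n -> va_mode u n vacuum = 0;
  va_borcherds : borcherds va_mode va_mode
}.

Record vaModule (C : fieldType) (V : vertexAlgebra C) := VaModule {
  mod_space :> lmodType C;
  mod_mode : V -> int -> mod_space -> mod_space;
  mod_bilinear : bilinear_modes mod_mode;
  mod_truncated : truncated_modes mod_mode;
  mod_vacuum : forall n w, mod_mode (vacuum V) n w = if n == -1 then w else 0;
  mod_borcherds : borcherds (@va_mode C V) mod_mode
}.

Arguments va_mode {C v} _ _ _.
Arguments mod_mode {C V v} _ _ _.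

Section VertexOperatorAlgebras.
Variables (C : fieldType) (V : vertexAlgebra C).

Definition simple_va : Prop :=
  vacuum V <> 0 /\
  forall I : set V, subspace I ->
    (forall u n x, I x -> I (va_mode u n x)) ->
    (forall x n u, I x -> I (va_mode x n u)) ->
    trivial_subspace I.

Definition irreducible_module (M : vaModule V) : Prop :=
  (exists w : M, w <> 0) /\
  forall W : set M, subspace W ->
    (forall (u : V) n x, W x -> W (mod_mode u n x)) -> trivial_subspace W.

Definition weight_vector (omega : V) (n : int) (u : V) : Prop :=
  va_mode omega 1 u = n%:~R *: u.

(* omega is a conformal vector of central charge c, with L(n) = omega_(n+1). *)
Record is_voa (omega : V) (c : C) : Prop := IsVOA {
  voa_virasoro : forall (m n : int) (u : V),
    va_mode omega (m + 1) (va_mode omega (n + 1) u)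
    - va_mode omega (n + 1) (va_mode omega (m + 1) u)
    = (m - n)%:~R *: va_mode omega (m + n + 1) u
      + (if m + n == 0 then ((m ^+ 3 - m)%:~R / 12%:R * c) *: u else 0);
  voa_derivation : forall (u x : V) (n : int),
    va_mode (va_mode omega 0 u) n x = - n%:~R *: va_mode u (n - 1) x;
  voa_graded : forall u : V, exists (r : seq int) (x : int -> V),
    (forall n, weight_vector omega n (x n)) /\ u = \sum_(n <- r) x n;
  voa_finite_dim : forall n : int, exists b : seq V,
    forall u, weight_vector omega n u ->
      exists a : nat -> C, u = \sum_(j < size b) a j *: b`_j;
  voa_lower_bound : exists n0 : int, forall (n : int) (u : V),
    n < n0 -> weight_vector omega n u -> u = 0
}.

End VertexOperatorAlgebras.

Section AffineSl2.
Variables (C : fieldType) (k : nat).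

(* H m, E m, F m are the actions of h(m), e(m), f(m) on a module of level k;
   the invariant form is (h|h) = 2, (e|f) = 1. *)
Record affine_sl2_action (M : lmodType C) (H E F : int -> M -> M) : Prop :=
  AffineSl2Action {
  aff_hh : forall m n w, H m (H n w) - H n (H m w) =
    if m + n == 0 then ((2 * m)%:~R * k%:R) *: w else 0;
  aff_he : forall m n w, H m (E n w) - E n (H m w) = 2%:R *: E (m + n) w;
  aff_hf : forall m n w, H m (F n w) - F n (H m w) = - (2%:R *: F (m + n) w);
  aff_ef : forall m n w, E m (F n w) - F n (E m w) =
    H (m + n) w + (if m + n == 0 then (m%:~R * k%:R) *: w else 0);
  aff_ee : forall m n w, E m (E n w) = E n (E m w);
  aff_ff : forall m n w, F m (F n w) = F n (F m w)
}.

Variables (V : vertexAlgebra C) (h e f : V).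

(* The Sugawara vector. *)
Definition omega_aff : V :=
  (2 * (k + 2))%:R^-1 *:
    (2%:R^-1 *: va_mode h (-1) h + va_mode e (-1) f + va_mode f (-1) e).

(* V is L(k,0), with a(-1)1 identified with a for a = h, e, f. *)
Record is_Lk0 : Prop := IsLk0 {
  Lk0_voa : is_voa omega_aff ((3 * k)%:R / (k + 2)%:R);
  Lk0_affine : affine_sl2_action (va_mode h) (va_mode e) (va_mode f);
  Lk0_generated : forall W : set V, subspace W -> W (vacuum V) ->
    (forall n x, W x ->
       [/\ W (va_mode h n x), W (va_mode e n x) & W (va_mode f n x)]) ->
    forall x, W x;
  Lk0_simple : simple_va V
}.

(* M is L(k,i), with v j = v^{i,j} for j <= i (other values are irrelevant). *)
Record is_Lki (i : nat) (M : vaModule V) (v : nat -> M) : Prop := IsLki {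
  Lki_irreducible : irreducible_module M;
  Lki_top : exists lambda : C,
    (forall w : M, exists (N : nat) (x : nat -> M),
       (forall n, mod_mode omega_aff 1 (x n) = (lambda + n%:R) *: x n) /\
       w = \sum_(n < N) x n) /\
    (forall w : M, mod_mode omega_aff 1 w = lambda *: w <->
       exists a : nat -> C, w = \sum_(j < i.+1) a j *: v j);
  Lki_free : forall a : nat -> C, \sum_(j < i.+1) a j *: v j = 0 ->
    forall j, (j <= i)%N -> a j = 0;
  Lki_h : forall j, (j <= i)%N ->
    mod_mode h 0 (v j) = (i%:R - (2 * j)%:R) *: v j;
  Lki_e0 : mod_mode e 0 (v 0%N) = 0;
  Lki_e : forall j, (1 <= j <= i)%N ->
    mod_mode e 0 (v j) = (i - j + 1)%:R *: v j.-1;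
  Lki_fi : mod_mode f 0 (v i) = 0;
  Lki_f : forall j, (j < i)%N -> mod_mode f 0 (v j) = j.+1%:R *: v j.+1;
  Lki_pos : forall (j : nat) (n : int), (j <= i)%N -> 1 <= n ->
    [/\ mod_mode h n (v j) = 0, mod_mode e n (v j) = 0
      & mod_mode f n (v j) = 0]
}.

Definition K0 : set V := [set u | forall m : int, 0 <= m -> va_mode h m u = 0].

Definition omega_K0 : V :=
  (2 * k * (k + 2))%:R^-1 *:
    (- (k%:R *: va_mode h (-2) (vacuum V)) - va_mode h (-1) h
     + (2 * k)%:R *: va_mode e (-1) f).

End AffineSl2.

Section DeltaTwist.
Variables (C : fieldType) (V : vertexAlgebra C) (a : V).

(* Coefficient of z^(-p) in X^r u, where
   X = \sum_(m >= 1) a(m)/(-m) (-z)^(-m). *)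
Fixpoint delta_pow (r p : nat) (u : V) : V :=
  if r is r'.+1 then
    \sum_(1 <= m < p.+1)
      ((-1) ^+ m / - m%:R) *: va_mode a m%:Z (delta_pow r' (p - m) u)
  else if p == 0%N then u else 0.

(* Coefficient of z^(-p) in exp(X) u; X^r only involves powers z^(-p) with
   p >= r. *)
Definition delta_exp (p : nat) (u : V) : V :=
  \sum_(r < p.+1) (r`!)%:R^-1 *: delta_pow r p u.

(* Coefficient of z^(-n-1) in Y(Delta(a,z) u, z) w, n being a fractional
   index: z^(a(0)) is z^s on the s-eigenspace of a(0), so the term
   z^s z^(-p) z^(-m-1) contributes exactly when s = m - n + p.
   The sum is a finite-support sum.  For a = h'', the class of n mod Z of a
   nonzero mode is that of an eigenvalue of h''(0), i.e. is governed by the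
   eigenvalue of sigma = exp(2 pi i h''(0)). *)
Definition twisted_mode (M : vaModule V) (u : V) (n : rat) (w : M) : M :=
  \sum_(q \in [set: int * nat])
    mod_mode
      (eigen_component (va_mode a 0) (ratr (q.1%:~R - n + q.2%:R))
         (delta_exp q.2 u))
      q.1 w.

End DeltaTwist.

Section TwistedParafermion.
Variables (C : fieldType) (k : nat) (V : vertexAlgebra C) (h e f : V).
Variable M : vaModule V.

Definition h'' : V := 4%:R^-1 *: (e + f).

(* The action of the sigma-twisted module on the space M, sigma being
   h |-> -h, e |-> f, f |-> e. *)
Definition sigma_mode (u : V) (n : rat) (w : M) : M := twisted_mode h'' u n w.

(* d is the weight of u for L(0) = (omega_K0)_1. *)
Definition lowest_weight_vector (w : M) : Prop :=
  [/\ w <> 0,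
      exists lambda : C, sigma_mode (omega_K0 k h e f) 1 w = lambda *: w
    & forall (u : V) (d : int) (m : rat),
        K0 h u -> weight_vector (omega_K0 k h e f) d u ->
        d%:~R - 1 < m -> sigma_mode u m w = 0].

End TwistedParafermion.

(* Main.v *)
From HB Require Import structures.
Require Import Defs.
From mathcomp Require Import all_boot all_order all_algebra.
From mathcomp Require Import boolp classical_sets fsbigop reals.
From mathcomp Require Import complex.
From mathcomp Require Import ring lra zify.

Set Implicit Arguments.
Unset Strict Implicit.
Unset Printing Implicit Defensive.

Import Order.TTheory GRing.Theory Num.Theory.
Local Open Scope ring_scope.



(** Put $H = e+f$, $E = (h-e+f)/2$, $F = (h+e-f)/2$.  This is
    again an $sl_2$-triple, and $h'' = H/4$, so $h''(0)$ has eigenvalues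
    $0, 1/2, -1/2$ on $H, E, F$.  In the twisted module the modes of $E$ and $F$
    are therefore those of the untwisted module with index shifted by $1/2$ and
    $-1/2$, and $H$ acquires the constant $k/2$.  Hence $h = E + F$ and
    $e - f = F - E$ act with modes in $1/2 + Z$, and $e + f = H$ with modes
    in $Z$.

    The twisted module carries two gradings: the degree, which a mode $u_n$
    lowers by $n - wt(u) + 1$, and a parity, for which $h$ is even and $e$, $f$
    are odd.  On the algebra the parity is the automorphism
    $\exp(\pi\sqrt{-1}h(0)/2)$.  The vector $\eta$ is the lowest weight vector
    for $H$ in the top level, of weight $-k/2$: exactly the value that the
    constant $k/2$ cancels, so that $(e+f)_0\eta = 0$.  Because of this
    cancellation the relations among the modes of $h$ and $e \pm f$ are
    compatible with both gradings on the space generated by $\eta$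
    ([twisted_space_modes]), and below degree $1/2$ only the line of $\eta$
    survives, in degree $0$ and even, while the odd part of degree $1/2$ is
    the line of $w = (e-f)_{-1/2}\eta$ ([twisted_space_low]).

    A vector $u$ of $K_0$ has charge $0$ for $h(0)$, so it is even: its modes
    preserve the parity.  If $m > wt(u) - 1$, then $u_m$ strictly lowers the
    degree, so it maps $w$ to an odd vector of degree less than $1/2$, hence
    to $0$, and it kills $\eta$ too; $\omega_1$ preserves the lines of $\eta$
    and $w$.  Finally $(e-f)_{1/2}$ kills $\eta$ but sends $w$ to $-k\eta$, so
    $w$ is nonzero and not proportional to $\eta$.

    What has to be proved is that the modes of every $u$, not only of $h$, $e$
    and $f$, respect both gradings ([parity_graded]).  As $h, e, f$
    generate the algebra, this follows by induction from the twisted Borcherds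
    identity for the pair formed by $E$ or $F$ and an arbitrary $u$
    ([twisted_borcherds]).  That identity is derived from the untwisted one
    by the formula for the conjugate of $E(l)$ and $F(l)$ by
    $\Delta(h'',z)$ ([delta_exp_mode]) and the Vandermonde convolution. *)

(** * Linear identities in modules *)

(** Reflexive decision of identities between linear combinations in a module:
    [module_eq] reduces such an identity to the equality of the coefficients
    of each atom, which is left to [ring] or [field]. *)
Section ModuleExpressions.
Variables (C : comNzRingType) (M : lmodType C).

Inductive mexp :=
  | MZero | MAtom of nat | MAdd of mexp & mexp | MOpp of mexp
  | MScale of C & mexp.

Fixpoint meval (xs : seq M) (t : mexp) : M :=
  match t with
  | MZero => 0
  | MAtom i => xs`_i
  | MAdd t1 t2 => meval xs t1 + meval xs t2
  | MOpp t1 => - meval xs t1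
  | MScale c t1 => c *: meval xs t1
  end.

Fixpoint mcoef (i : nat) (t : mexp) : C :=
  match t with
  | MZero => 0
  | MAtom j => if Nat.eqb i j then 1 else 0
  | MAdd t1 t2 => mcoef i t1 + mcoef i t2
  | MOpp t1 => - mcoef i t1
  | MScale c t1 => c * mcoef i t1
  end.

Lemma meval_coef xs t : meval xs t = \sum_(i < size xs) mcoef i t *: xs`_i.
Proof.
elim: t => [|j|t1 IH1 t2 IH2|t1 IH1|c t1 IH1] /=.
- by rewrite big1 // => i _; rewrite scale0r.
- have [lj|gj] := ltnP j (size xs).
    rewrite (bigD1 (Ordinal lj)) //= PeanoNat.Nat.eqb_refl scale1r big1 ?addr0 //.
    move=> i neq; case: PeanoNat.Nat.eqb_spec => [eqij|_]; last by rewrite scale0r.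
    by case/eqP: neq; apply: val_inj.
  rewrite nth_default // big1 // => i _; case: PeanoNat.Nat.eqb_spec => [eqij|_].
    by have := ltn_ord i; rewrite eqij ltnNge gj.
  by rewrite scale0r.
- by rewrite IH1 IH2 -big_split; apply: eq_bigr => i _; rewrite scalerDl.
- by rewrite IH1 -sumrN; apply: eq_bigr => i _; rewrite scaleNr.
- by rewrite IH1 scaler_sumr; apply: eq_bigr => i _; rewrite scalerA.
Qed.

Fixpoint mcoef_eq (n : nat) (t1 t2 : mexp) : Prop :=
  if n is n'.+1 then mcoef n' t1 = mcoef n' t2 /\ mcoef_eq n' t1 t2 else True.

Lemma meval_eq xs t1 t2 :
  mcoef_eq (size xs) t1 t2 -> meval xs t1 = meval xs t2.
Proof.
move=> eqt; rewrite !meval_coef; apply: eq_bigr => -[i ltis] _ /=.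
congr (_ *: _); elim: (size xs) eqt ltis => //= n IH [eqn eqt].
by rewrite ltnS leq_eqVlt => /predU1P[->|/IH]; [|apply].
Qed.

End ModuleExpressions.

Ltac mod_atom x xs :=
  lazymatch xs with
  | nil => fail
  | ?y :: ?ys =>
    match goal with
    | _ => let _ := match goal with _ => unify x y end in constr:(0%N)
    | _ => let n := mod_atom x ys in constr:(n.+1)
    end
  end.

Ltac mod_atoms t xs :=
  lazymatch t with
  | @GRing.add _ ?a ?b => let ys := mod_atoms a xs in mod_atoms b ys
  | @GRing.opp _ ?a => mod_atoms a xs
  | @GRing.scale _ _ _ ?a => mod_atoms a xs
  | @GRing.zero _ => xs
  | ?x => match goal with
          | _ => let _ := mod_atom x xs in xs
          | _ => constr:(x :: xs)
          end
  end.

Ltac mod_reify C t xs :=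
  lazymatch t with
  | @GRing.add _ ?a ?b =>
      let ra := mod_reify C a xs in let rb := mod_reify C b xs in
      constr:(MAdd ra rb)
  | @GRing.opp _ ?a => let ra := mod_reify C a xs in constr:(MOpp ra)
  | @GRing.scale _ _ ?c ?a =>
      let ra := mod_reify C a xs in constr:(@MScale C c ra)
  | @GRing.zero _ => constr:(MZero C)
  | ?x => let n := mod_atom x xs in constr:(MAtom C n)
  end.

Ltac mod_split :=
  lazymatch goal with
  | |- _ /\ _ => split; [idtac | mod_split]
  | |- True => exact I
  end.

Ltac module_eq C :=
  lazymatch goal with
  | |- @eq ?M ?a ?b =>
    let xs0 := mod_atoms a (@nil M) in
    let xs := mod_atoms b xs0 in
    let ra := mod_reify C a xs in
    let rb := mod_reify C b xs in
    apply: (@meval_eq C _ xs ra rb);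
    cbv [mcoef_eq size mcoef Nat.eqb]; mod_split
  end.

(** * Sums and generalized binomial coefficients *)
Section Combinatorics.

(** The sum of $F$ over the triangle $i + q < P$ equals its sum over a rectangle
    inside the triangle and containing the support of $F$. *)
Lemma sum_convolution (A : nmodType) (F : nat -> nat -> A) (N Q P : nat) :
  (N + Q <= P)%N ->
  (forall i q, (N <= i)%N || (Q <= q)%N -> F i q = 0) ->
  \sum_(p < P) \sum_(i < p.+1) F i (p - i)%N = \sum_(i < N) \sum_(q < Q) F i q.
Proof.
move=> leP F0.
transitivity (\sum_(p < P) \sum_(i < P | (i <= p)%N) F i (p - i)%N).
  apply: eq_bigr => p _.
  exact: (big_ord_widen_cond P predT (fun i => F i (p - i)%N) (ltn_ord p)).
rewrite (exchange_big_dep predT) //=.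
transitivity (\sum_(i < P) \sum_(q < Q) F i q); last first.
  rewrite [RHS](big_ord_widen P (fun i => \sum_(q < Q) F i q)); last by lia.
  rewrite [in RHS]big_mkcond /=; apply: eq_bigr => i _.
  by case: ltnP => // leN; rewrite big1 // => q _; rewrite F0 ?leN.
apply: eq_bigr => i _.
have [ltiN|leNi] := ltnP i N; last first.
  by rewrite !big1 // => q _; rewrite F0 ?leNi.
rewrite -(big_mkord (fun p => (i <= p)%N) (fun p => F i (p - i)%N)).
rewrite (big_cat_nat (leq0n i)) /=; last by lia.
rewrite big_nat_cond big1 ?add0r; last by move=> p; lia.
rewrite -{1}[i : nat]add0n big_addn -(subnKC (m := Q) (n := P - i)); last by lia.
rewrite big_mkord big_split_ord /= [X in _ + X]big1 ?addr0.
  by apply: eq_big => [q|q _]; rewrite ?leq_addl ?addnK.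
by move=> q _; rewrite F0 //; lia.
Qed.

Variable C : numFieldType.
Implicit Types (x y : C).

Lemma gbinom0 x : gbinom x 0 = 1.
Proof. by rewrite /gbinom big_ord0 fact0 divr1. Qed.

Lemma gbinomS x j : j.+1%:R * gbinom x j.+1 = (x - j%:R) * gbinom x j.
Proof.
rewrite /gbinom big_ord_recr /= factS natrM.
have f0 : (j`!)%:R != 0 :> C by rewrite pnatr_eq0 -lt0n fact_gt0.
have j0 : j.+1%:R != 0 :> C by rewrite pnatr_eq0.
by field; rewrite f0 nat1r.
Qed.

Lemma gbinom1 x : gbinom x 1 = x.
Proof. by have := gbinomS x 0; rewrite gbinom0 mul1r mulr1 subr0. Qed.

Lemma gbinom_nat (m j : nat) : (m < j)%N -> gbinom (m%:R : C) j = 0.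
Proof.
move=> ltmj; rewrite /gbinom (bigD1 (Ordinal ltmj)) //=.
by rewrite subrr !mul0r.
Qed.

(** Both sides satisfy $(t+1) c_{t+1} = (x + y - t) c_t$. *)
Lemma gbinom_vandermonde x y t :
  \sum_(i < t.+1) gbinom x i * gbinom y (t - i) = gbinom (x + y) t.
Proof.
elim: t => [|t IH]; first by rewrite big_ord1 !gbinom0 mulr1.
have t0 : t.+1%:R != 0 :> C by rewrite pnatr_eq0.
apply: (mulfI t0); rewrite gbinomS -IH mulr_sumr.
transitivity (\sum_(i < t.+2) i%:R * gbinom x i * gbinom y (t.+1 - i)
   + \sum_(i < t.+2) gbinom x i * ((t.+1 - i)%:R * gbinom y (t.+1 - i))).
  rewrite -big_split; apply: eq_bigr => i _ /=.
  have -> : t.+1%:R = i%:R + (t.+1 - i)%:R :> C.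
    by rewrite -natrD subnKC // -ltnS.
  by ring.
rewrite big_ord_recl !mul0r add0r [X in _ + X]big_ord_recr /= subnn mul0r mulr0.
rewrite addr0 mulr_sumr -big_split; apply: eq_bigr => i _ /=.
have leit : (i <= t)%N by rewrite -ltnS.
rewrite /bump leq0n add1n subSS gbinomS subSn // gbinomS natrB //.
by ring.
Qed.

(** The coefficients of $S^t$ in $S\,d/dS\,(1+S)^x = x S (1+S)^{-1} (1+S)^x$. *)
Lemma gbinom_log_derivative x t :
  x * (\sum_(m < t) (-1) ^+ m * gbinom x (t.-1 - m)) = t%:R * gbinom x t.
Proof.
elim: t => [|t IH]; first by rewrite big_ord0 mulr0 mul0r.
rewrite big_ord_recl /= expr0 mul1r subn0.
have -> : \sum_(i < t) (-1) ^+ bump 0 i * gbinom x (t - bump 0 i)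
    = - \sum_(m < t) (-1) ^+ m * gbinom x (t.-1 - m).
  rewrite -sumrN; apply: eq_bigr => i _; rewrite /bump leq0n add1n exprS.
  by rewrite -predn_sub subnS mulN1r mulNr.
by rewrite mulrDr mulrN IH gbinomS; ring.
Qed.

End Combinatorics.

(** * Eigencomponents *)
Section EigenComponents.
Variables (C : fieldType) (V : lmodType C) (A : {linear V -> V}).


Definition eigenlist (l : seq (C * V)) :=
  forall p, p \in l -> A p.2 = p.1 *: p.2.

(** Eigenvectors for distinct eigenvalues are independent: applying $A - t$ for
    one of the eigenvalues $t$ shortens the list and rescales $x$ by
    $s - t \ne 0$. *)
Lemma eigenvalue_separation (l : seq (C * V)) s x :
  eigenlist l -> (forall p, p \in l -> p.1 != s) ->
  A x = s *: x -> x = \sum_(p <- l) p.2 -> x = 0.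
Proof.
elim: {l}(size l) {-2}l (erefl (size l)) x => [|n IH] [|p l] //= szl x hl hs Ax xE.
  by rewrite xE big_nil.
have hp := hl p (mem_head _ _).
have hs0 := hs p (mem_head _ _).
have xp0 : (s - p.1) *: x = 0.
  apply: (IH [seq (q.1, (q.1 - p.1) *: q.2) | q <- l]).
  - by rewrite size_map; case: szl.
  - move=> _ /mapP[q lq ->] /=.
    by rewrite linearZ /= hl ?inE ?lq ?orbT // !scalerA mulrC.
  - by move=> _ /mapP[q lq ->] /=; rewrite hs // inE lq orbT.
  - by rewrite linearZ /= Ax !scalerA mulrC.
  rewrite big_map /= scalerBl -Ax xE linear_sum scaler_sumr -sumrB big_cons.
  rewrite hp subrr add0r; apply: eq_big_seq => q lq.
  by rewrite hl ?inE ?lq ?orbT // scalerBl.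
by move/eqP: xp0; rewrite scaler_eq0 subr_eq0 eq_sym (negbTE hs0) => /eqP.
Qed.

Lemma eigenlist_component l s :
  eigenlist l -> A (\sum_(p <- l | p.1 == s) p.2) = s *: \sum_(p <- l | p.1 == s) p.2.
Proof.
move=> hl; rewrite linear_sum scaler_sumr [LHS]big_seq_cond [RHS]big_seq_cond.
by apply: eq_bigr => p /andP[lp /eqP <-]; rewrite hl.
Qed.

Lemma eigenlist_eigenvector l s x :
  eigenlist l -> A x = s *: x -> x = \sum_(p <- l) p.2 ->
  x = \sum_(p <- l | p.1 == s) p.2.
Proof.
move=> hl Ax xE; apply/eqP; rewrite -subr_eq0; apply/eqP.
apply: (@eigenvalue_separation [seq p <- l | p.1 != s] s).
- by move=> p; rewrite mem_filter => /andP[_ /hl].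
- by move=> p; rewrite mem_filter => /andP[].
- by rewrite linearB /= Ax eigenlist_component // scalerBr.
by rewrite big_filter {1}xE (bigID (fun p => p.1 == s)) /= addrC addrK.
Qed.

Lemma eigen_componentE l s :
  eigenlist l ->
  eigen_component A s (\sum_(p <- l) p.2) = \sum_(p <- l | p.1 == s) p.2.
Proof.
move=> hl; apply: xget_unique => /=.
  split; first exact: eigenlist_component.
  exists [seq t <- undup [seq p.1 | p <- l] | t != s],
    (fun t => \sum_(p <- l | p.1 == t) p.2); split.
  - by rewrite mem_filter eqxx.
  - by move=> t; apply: eigenlist_component.
  rewrite (bigID (fun p => p.1 == s)) /=; congr (_ + _).
  rewrite big_filter (exchange_big_dep (fun p => p.1 != s)) /=; last first.
    by move=> t p ts /eqP->.
  rewrite [LHS]big_seq_cond [RHS]big_seq_cond; apply: eq_bigr => p /andP[lp ps].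
  rewrite -big_filter (_ : [seq _ <- _ | _] = [:: p.1]) ?big_seq1 //.
  have -> : [seq t <- undup [seq p0.1 | p0 <- l] | (t != s) && (p.1 == t)]
     = [seq t <- undup [seq p0.1 | p0 <- l] | pred1 p.1 t].
    apply: eq_filter => t /=; rewrite [in RHS]eq_sym.
    by case: (p.1 =P t) => [<-|_]; rewrite ?ps ?andbF.
  by rewrite filter_pred1_uniq ?undup_uniq // mem_undup map_f.
move=> y [Ay [r [z [rs Az uE]]]].
apply/eqP; rewrite -subr_eq0; apply/eqP.
apply: (@eigenvalue_separation
  ([seq p <- l | p.1 != s] ++ [seq (t, - z t) | t <- r]) s).
- move=> p; rewrite mem_cat mem_filter => /orP[/andP[_ /hl //]|/mapP[t _ ->]] /=.
  by rewrite linearN /= Az scalerN.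
- move=> p; rewrite mem_cat mem_filter => /orP[/andP[]//|/mapP[t tr ->]] /=.
  by apply: contraNneq rs => <-.
- by rewrite linearB /= Ay eigenlist_component // scalerBr.
rewrite big_cat big_filter big_map /= sumrN.
have -> : y = \sum_(p <- l) p.2 - \sum_(t <- r) z t by rewrite uE addrK.
by rewrite (bigID (fun p => p.1 == s) predT) /= addrAC [X in X - _]addrAC subrr add0r.
Qed.

End EigenComponents.

(** * Modes and affine commutators *)
Section Modes.
Variables (C : numFieldType) (V : vertexAlgebra C).

(** Lemmas on modules apply to the algebra itself through this module. *)
Definition adjoint_module : vaModule V :=
  VaModule (@va_bilinear C V) (@va_truncated C V) (@va_vacuum C V)
    (@va_borcherds C V).

Section Module.
Variable M : vaModule V.

Fact mod_mode_is_linear (u : V) n : linear (@mod_mode C V M u n).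
Proof. by move=> a w w'; rewrite (proj2 (@mod_bilinear C V M)). Qed.

HB.instance Definition _ u n :=
  GRing.isLinear.Build C M M *:%R (@mod_mode C V M u n) (mod_mode_is_linear u n).

Definition mode_at n (w : M) (u : V) : M := mod_mode u n w.

Fact mode_at_is_linear n w : linear (mode_at n w).
Proof. by move=> a u u'; rewrite /mode_at (proj1 (@mod_bilinear C V M)). Qed.

HB.instance Definition _ n w :=
  GRing.isLinear.Build C V M *:%R (mode_at n w) (mode_at_is_linear n w).

Lemma modeDl u u' n w : @mod_mode C V M (u + u') n w = mod_mode u n w + mod_mode u' n w.
Proof. exact: (linearD (mode_at n w)). Qed.
Lemma modeNl u n w : @mod_mode C V M (- u) n w = - mod_mode u n w.
Proof. exact: (linearN (mode_at n w)). Qed.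
Lemma modeZl a u n w : @mod_mode C V M (a *: u) n w = a *: mod_mode u n w.
Proof. exact: (linearZZ (mode_at n w)). Qed.
Lemma mode0l n w : @mod_mode C V M 0 n w = 0.
Proof. exact: (linear0 (mode_at n w)). Qed.
Lemma mode_suml I (r : seq I) (P : pred I) (F : I -> V) n w :
  @mod_mode C V M (\sum_(i <- r | P i) F i) n w = \sum_(i <- r | P i) mod_mode (F i) n w.
Proof. exact: (linear_sum (mode_at n w)). Qed.

Lemma mode_truncated (u : V) (m : int) (w : M) :
  exists N : nat, forall j : nat, (N <= j)%N -> mod_mode u (m + j%:Z) w = 0.
Proof.
have [N0 hN] := @mod_truncated C V M u w.
by exists `|N0 - m|%N => j lej; apply: hN; lia.
Qed.

End Module.

Lemma va_mode_truncated (u v : V) (m : int) :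
  exists N : nat, forall j : nat, (N <= j)%N -> va_mode u (m + j%:Z) v = 0.
Proof. exact: (@mode_truncated adjoint_module). Qed.

Fact va_mode_is_linear (u : V) n : linear (va_mode u n).
Proof. exact: (@mod_mode_is_linear adjoint_module). Qed.

HB.instance Definition _ u n :=
  GRing.isLinear.Build C V V *:%R (@va_mode C V u n) (va_mode_is_linear u n).

Lemma mode_borcherds_from (M : vaModule V) (u v : V) (w : M) (l m n : int) :
  exists N0 : nat, forall N : nat, (N0 <= N)%N ->
    \sum_(j < N) gbinom (m%:~R : C) j *:
        mod_mode (va_mode u (l + j%:Z) v) (m + n - j%:Z) w
    = \sum_(j < N) ((-1) ^+ j * gbinom (l%:~R : C) j) *:
        (mod_mode u (l + m - j%:Z) (mod_mode v (n + j%:Z) w)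
         - (-1) ^ l *: mod_mode v (l + n - j%:Z) (mod_mode u (m + j%:Z) w)).
Proof.
have [N1 h1] := va_mode_truncated u v l.
have [N2 h2] := mode_truncated u m w.
have [N3 h3] := mode_truncated v n w.
exists (N1 + N2 + N3)%N => N leN; apply: mod_borcherds => j lej.
by split; [apply: h1|apply: h2|apply: h3]; lia.
Qed.

(** The case $l = 0$ of the Borcherds identity is the commutator formula. *)
Lemma mode_commutator (M : vaModule V) (u v : V) (w : M) (m n : int) :
  exists N0 : nat, forall N : nat, (N0 <= N)%N ->
  mod_mode u m (mod_mode v n w) - mod_mode v n (mod_mode u m w)
  = \sum_(j < N) gbinom (m%:~R : C) j *:
        mod_mode (va_mode u j%:Z v) (m + n - j%:Z) w.
Proof.
have [N0 hN] := mode_borcherds_from u v w 0 m n.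
exists N0.+1 => -[//|N] leN.
have := hN N.+1 (ltnW leN); under eq_bigr do rewrite add0r.
move=> ->; rewrite big_ord_recl big1 => [|i _].
  by rewrite gbinom0 expr0 mul1r scale1r expr0z scale1r !subr0 !add0r !addr0.
by rewrite (@gbinom_nat C 0 (lift ord0 i)) // mulr0 scale0r.
Qed.

(** In the commutator formula the products $a_j b$ with $j \ge 2$ vanish, $a_0 b$
    gives the bracket and $a_1 b$ the central term. *)
Lemma affine_commutator (M : vaModule V) (a b c : V) (kappa : C) :
  va_mode a 0 b = c -> va_mode a 1 b = kappa *: vacuum V ->
  (forall j : nat, (1 < j)%N -> va_mode a j%:Z b = 0) ->
  forall (m n : int) (w : M),
  mod_mode a m (mod_mode b n w) - mod_mode b n (mod_mode a m w)
  = mod_mode c (m + n) w + (if m + n == 0 then (m%:~R * kappa) *: w else 0).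
Proof.
move=> ab0 ab1 ab m n w; have [N hN] := mode_commutator a b w m n.
rewrite (hN N.+2); last by lia.
rewrite !big_ord_recl /= big1 ?addr0 => [|i _]; last first.
  by rewrite ab // mode0l scaler0.
rewrite ab0 gbinom0 scale1r (_ : bump 0 0 = 1%N) // ab1 gbinom1 modeZl mod_vacuum scalerA.
by rewrite subr_eq addNr; case: eqP => // _; rewrite scaler0.
Qed.

End Modes.

Section VaModeLinear.
Variables (C : numFieldType) (V : vertexAlgebra C).

Lemma va_modeDl (u u' : V) n w : va_mode (u + u') n w = va_mode u n w + va_mode u' n w.
Proof. exact: (@modeDl C V (adjoint_module V)). Qed.
Lemma va_modeNl (u : V) n w : va_mode (- u) n w = - va_mode u n w.
Proof. exact: (@modeNl C V (adjoint_module V)). Qed.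
Lemma va_modeZl a (u : V) n w : va_mode (a *: u) n w = a *: va_mode u n w.
Proof. exact: (@modeZl C V (adjoint_module V)). Qed.

Lemma va_mode0l n (w : V) : va_mode (0 : V) n w = 0.
Proof. exact: (@mode0l C V (adjoint_module V)). Qed.

End VaModeLinear.

Section RotatedTriple.
Variables (C : numFieldType) (k : nat) (M : lmodType C).
Variables (H E F : int -> {linear M -> M}).
Hypothesis act : affine_sl2_action k H E F.

Let H' n w := E n w + F n w.
Let E' n w := 2%:R^-1 *: (H n w - E n w + F n w).
Let F' n w := 2%:R^-1 *: (H n w + E n w - F n w).

(** Conjugation by an element of $SL_2$: $(E + F, (H-E+F)/2, (H+E-F)/2)$ is the
    image of $(H,E,F)$ under an automorphism of $sl_2$, hence of its affine Lie
    algebra. *)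
Lemma affine_rotation : affine_sl2_action k H' E' F'.
Proof.
have eqn x y z : x - y = z -> x = y + z :> M by move=> <-; rewrite addrC subrK.
pose hh m n w := eqn _ _ _ (aff_hh act m n w).
pose he m n w := eqn _ _ _ (aff_he act m n w).
pose hf m n w := eqn _ _ _ (aff_hf act m n w).
pose ef m n w := eqn _ _ _ (aff_ef act m n w).
pose ee m n w := aff_ee act m n w.
pose ff m n w := aff_ff act m n w.
have neg (X : int -> {linear M -> M}) m (x : M) : X m (- x) = - X m x.
  by rewrite linearN.
have add (X : int -> {linear M -> M}) m (x y : M) : X m (x + y) = X m x + X m y.
  by rewrite linearD.
have scale (X : int -> {linear M -> M}) m (x : M) c : X m (c *: x) = c *: X m x.
  by rewrite linearZ.
split=> m n w; have sw := addrC n m; rewrite /H' /E' /F';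
  rewrite ?(scale H, scale E, scale F) ?(add H, add E, add F) ?(neg H, neg E, neg F)
    ?(hh m n) ?(ee m n) ?(ff m n) ?(he m n) ?(hf m n) ?(he n m) ?(hf n m)
    ?(ef m n) ?(ef n m) ?sw /=;
  try (case: eqP => [mn0|_];
    [rewrite (_ : n = - m) ?rmorphN ?rmorphM /=; last by (apply/eqP; rewrite -addr_eq0 addrC mn0)|]);
  by module_eq C; field.
Qed.

End RotatedTriple.

Section AffineModule.
Variables (C : numFieldType) (V : vertexAlgebra C).

(** The relations on the adjoint module determine the products $a_j b$,
    because $b = b_{-1}1$ and $a_j 1 = 0$ for $j \ge 0$; and these products determine
    the commutators on every module. *)
Lemma affine_commutator_module (M : vaModule V) (a b c : V) (kappa : C) :
  (forall m n (w : V), va_mode a m (va_mode b n w) - va_mode b n (va_mode a m w)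
    = va_mode c (m + n) w
      + (if m + n == 0 then (m%:~R * kappa) *: w else 0)) ->
  forall m n (w : M), mod_mode a m (mod_mode b n w) - mod_mode b n (mod_mode a m w)
    = mod_mode c (m + n) w
      + (if m + n == 0 then (m%:~R * kappa) *: w else 0).
Proof.
move=> comV; have vac (j : nat) : va_mode a j%:Z b = va_mode c (j%:Z - 1) (vacuum V)
    + (if j%:Z - 1 == 0 then (j%:~R * kappa) *: vacuum V else 0).
  by rewrite -comV va_creation va_creation0 // linear0 subr0.
apply: affine_commutator => [||j j1].
- by rewrite vac add0r va_creation addr0.
- by rewrite vac subrr va_creation0 // add0r mul1r.
rewrite vac va_creation0; last by lia.
by rewrite add0r ifF //; apply/eqP; lia.
Qed.

Lemma affine_module (M : vaModule V) (k : nat) (a b c : V) :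
  affine_sl2_action k (va_mode a) (va_mode b) (va_mode c) ->
  affine_sl2_action k (@mod_mode C V M a) (mod_mode b) (mod_mode c).
Proof.
move=> act; split=> m n w.
- rewrite (@affine_commutator_module M a a 0 (2 * k)%:R) ?mode0l ?add0r.
    by rewrite rmorphM natrM mulrCA mulrA.
  move=> m' n' w'; rewrite (aff_hh act) va_mode0l add0r.
  by rewrite rmorphM natrM mulrCA mulrA.
- rewrite (@affine_commutator_module M a b (2%:R *: b) 0) ?modeZl ?mulr0 ?scale0r ?if_same ?addr0 //.
  by move=> m' n' w'; rewrite (aff_he act) va_modeZl mulr0 scale0r if_same addr0.
- rewrite (@affine_commutator_module M a c (- (2%:R *: c)) 0) ?modeNl ?modeZl
    ?mulr0 ?scale0r ?if_same ?addr0 //.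
  by move=> m' n' w'; rewrite (aff_hf act) va_modeNl va_modeZl mulr0 scale0r if_same addr0.
- by rewrite (@affine_commutator_module M b c a k%:R) // => m' n' w'; rewrite (aff_ef act).
- apply/eqP; rewrite -subr_eq0; apply/eqP.
  rewrite (@affine_commutator_module M b b 0 0) ?mode0l ?mulr0 ?scale0r ?if_same ?addr0 //.
  by move=> m' n' w'; rewrite (aff_ee act) subrr va_mode0l mulr0 scale0r if_same addr0.
apply/eqP; rewrite -subr_eq0; apply/eqP.
rewrite (@affine_commutator_module M c c 0 0) ?mode0l ?mulr0 ?scale0r ?if_same ?addr0 //.
by move=> m' n' w'; rewrite (aff_ff act) subrr va_mode0l mulr0 scale0r if_same addr0.
Qed.

(** Obtained by letting the commutator of $x_n$ and $y_{-1}$ act on the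
    vacuum. *)
Lemma affine_on_vacuum (k : nat) (a b c : V) :
  affine_sl2_action k (va_mode a) (va_mode b) (va_mode c) -> 
  forall n : int, 0 <= n -> 
  [/\ va_mode a n a = if n == 1 then (2 * k)%:R *: vacuum V else 0,
      va_mode a n b = if n == 0 then 2%:R *: b else 0,
      va_mode a n c = if n == 0 then - (2%:R *: c) else 0,
      va_mode b n b = 0 & va_mode c n c = 0] /\
  [/\ va_mode b n c = (if n == 0 then a else if n == 1 then k%:R *: vacuum V else 0),
      va_mode c n b = (if n == 0 then - a else if n == 1 then k%:R *: vacuum V else 0),
      va_mode b n a = (if n == 0 then - (2%:R *: b) else 0) &
      va_mode c n a = (if n == 0 then 2%:R *: c else 0)].
Proof.
move=> act n n0.
have via x y : va_mode x n y = va_mode x n (va_mode y (-1) (vacuum V))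
    - va_mode y (-1) (va_mode x n (vacuum V)).
  by rewrite va_creation va_creation0 // linear0 subr0.
have vac x : va_mode x (n - 1) (vacuum V) = if n == 0 then x else 0.
  by case: eqP => [->|n1]; [rewrite sub0r va_creation|rewrite va_creation0 //; lia].
have via' x y : va_mode x n y = - (va_mode y (-1) (va_mode x n (vacuum V))
    - va_mode x n (va_mode y (-1) (vacuum V))).
  by rewrite opprB; exact: via.
split; split.
- rewrite via (aff_hh act) subr_eq0; case: eqP => // ->.
  by rewrite mulr1 -natrM.
- by rewrite via (aff_he act) vac; case: eqP; rewrite ?scaler0.
- by rewrite via (aff_hf act) vac; case: eqP; rewrite ?scaler0 ?oppr0.
- by rewrite via (aff_ee act) subrr.
- by rewrite via (aff_ff act) subrr.
- rewrite via (aff_ef act) vac subr_eq0; case: (n =P 0) => [->|_]; first by rewrite addr0.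
  by rewrite add0r; case: eqP => // ->; rewrite mul1r.
- rewrite via' (aff_ef act) [-1 + n]addrC vac subr_eq0; case: (n =P 0) => [->|_]; first by rewrite addr0.
  by rewrite add0r; case: eqP => // _; rewrite ?oppr0 // mulN1r scaleNr opprK.
- by rewrite via' (aff_he act) [-1 + n]addrC vac; case: eqP; rewrite ?scaler0 ?oppr0.
- by rewrite via' (aff_hf act) [-1 + n]addrC vac; case: eqP; rewrite ?scaler0 ?oppr0 ?opprK.
Qed.

End AffineModule.

(** * Conformal weights *)
Lemma gbinomN1 (C : numFieldType) j : gbinom (-1 : C) j = (-1) ^+ j.
Proof.
elim: j => [|j IH]; first by rewrite gbinom0.
have j0 : j.+1%:R != 0 :> C by rewrite pnatr_eq0.
by apply: (mulfI j0); rewrite gbinomS IH exprS -natr1; ring.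
Qed.

Section Weights.
Variables (C : numFieldType) (V : vertexAlgebra C).

(** The Borcherds identity with $l = -1$, for which all coefficients on the right
    are $1$. *)
Lemma normal_product_mode1 (x y a : V) :
  exists N0 : nat, forall N : nat, (N0 <= N)%N ->
  va_mode (va_mode x (-1) y) 1 a
  = \sum_(j < N) (va_mode x (-1 - j%:Z) (va_mode y (1 + j%:Z) a)
                  + va_mode y (- j%:Z) (va_mode x j%:Z a)).
Proof.
have [N0 hN] := @mode_borcherds_from C V (adjoint_module V) x y a (-1) 0 1.
exists N0.+1 => -[//|N] leN.
have /= := hN N.+1 (ltnW leN); rewrite big_ord_recl big1 => [|i _]; last first.
  by rewrite (@gbinom_nat C 0 (lift ord0 i)) // scale0r.
rewrite gbinom0 scale1r /= !addr0 add0r => ->.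
apply: eq_bigr => i _; rewrite rmorphN1 gbinomN1 -exprMn mulrNN mulr1 expr1n.
by rewrite scale1r !add0r exprN1 invrN1 scaleN1r opprK.
Qed.

Variables (k : nat) (h e f : V).
Hypothesis act : affine_sl2_action k (va_mode h) (va_mode e) (va_mode f).

(** The modes of index $1$ of $h(-1)h/2$, $e(-1)f$ and $f(-1)e$ multiply $h$ by
    $2k$, $2$ and $2$, and similarly for $e$ and $f$: the Casimir of the adjoint
    representation shifts $k$ by the dual Coxeter number $2$. *)
Lemma sugawara_weight1 (a : V) :
  a = h \/ a = e \/ a = f -> va_mode (omega_aff k h e f) 1 a = a.
Proof.
move=> ha; have [[hh0 he0 hf0 ee0 ff0] [ef0 fe0 eh0 fh0]] := affine_on_vacuum act (lexx 0).
have [[hh1 he1 hf1 ee1 ff1] [ef1 fe1 eh1 fh1]] := affine_on_vacuum act ler01.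
have zero (x : V) (j : nat) : x = h \/ x = e \/ x = f -> va_mode x j.+2%:Z a = 0.
  have [[? ? ? ? ?] [? ? ? ?]] := affine_on_vacuum act (isT : 0 <= j.+2%:Z).
  by case: ha => [->|[->|->]] [->|[->|->]].
have prod x y : x = h \/ x = e \/ x = f -> y = h \/ y = e \/ y = f ->
   va_mode (va_mode x (-1) y) 1 a = va_mode x (-1) (va_mode y 1 a)
     + va_mode y 0 (va_mode x 0 a) + va_mode y (-1) (va_mode x 1 a).
  move=> hx hy; have [N hN] := normal_product_mode1 x y a.
  rewrite (hN N.+2) 1?leqW // !big_ord_recl /= big1 => [|i _].
    rewrite !addr0; change (va_mode x (-1) (va_mode y 1 a)
      + va_mode y 0 (va_mode x 0 a) + (va_mode x (-2) (va_mode y 2%:Z a)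
      + va_mode y (-1) (va_mode x 1 a)) = va_mode x (-1) (va_mode y 1 a)
      + va_mode y 0 (va_mode x 0 a) + va_mode y (-1) (va_mode x 1 a)).
    by rewrite (zero y 0%N) // linear0 add0r.
  change (va_mode x (-1 - i.+2%:Z) (va_mode y i.+3%:Z a)
    + va_mode y (- i.+2%:Z) (va_mode x i.+2%:Z a) = 0).
  by rewrite !zero // !linear0 addr0.
have hi : h = h \/ h = e \/ h = f by left.
have ei : e = h \/ e = e \/ e = f by right; left.
have fi : f = h \/ f = e \/ f = f by right; right.
have k0 : k%:R + 2%:R != 0 :> C by rewrite -natrD pnatr_eq0 addn2.
rewrite /omega_aff va_modeZl !va_modeDl va_modeZl !prod //.
case: ha => [->|[->|->]];
rewrite ?hh0 ?he0 ?hf0 ?ee0 ?ff0 ?ef0 ?fe0 ?eh0 ?fh0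
  ?hh1 ?he1 ?hf1 ?ee1 ?ff1 ?ef1 ?fe1 ?eh1 ?fh1 ?linear0 ?linearN /=
  ?(linearZ, linearN) /= ?va_creation
  ?hh0 ?he0 ?hf0 ?ee0 ?ff0 ?ef0 ?fe0 ?eh0 ?fh0 ?eqxx;
rewrite ?natrM natrD; by module_eq C; field.
Qed.


End Weights.

Section GradedSums.
Variables (C : fieldType) (V : lmodType C) (I : eqType) (B : I -> V -> Prop).

(** The list is labelled so that the degrees of the summands remain available
    without a choice. *)
Definition graded_sum (x : V) :=
  exists l : seq (I * V),
    (forall p, p \in l -> B p.1 p.2) /\ x = \sum_(p <- l) p.2.

Lemma graded_sum0 : graded_sum 0.
Proof. by exists [::]; rewrite big_nil. Qed.

Lemma graded_sumD x y : graded_sum x -> graded_sum y -> graded_sum (x + y).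
Proof.
move=> [l [hl ->]] [l' [hl' ->]]; exists (l ++ l'); rewrite big_cat; split=> //.
by move=> p; rewrite mem_cat => /orP[/hl|/hl'].
Qed.

Lemma graded_sum1 i x : B i x -> graded_sum x.
Proof.
by move=> Bx; exists [:: (i, x)]; rewrite big_seq1; split=> // p; rewrite inE => /eqP->.
Qed.

Hypothesis BZ : forall i c x, B i x -> B i (c *: x).

Lemma graded_sumZ c x : graded_sum x -> graded_sum (c *: x).
Proof.
move=> [l [hl ->]]; exists [seq (p.1, c *: p.2) | p <- l].
rewrite big_map scaler_sumr; split=> // _ /mapP[p lp ->]; exact: BZ (hl _ lp).
Qed.

Lemma graded_sum_linear (f : {linear V -> V}) :
  (forall i x, B i x -> graded_sum (f x)) ->
  forall x, graded_sum x -> graded_sum (f x).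
Proof.
move=> hf _ [l [hl ->]]; rewrite linear_sum.
elim: l hl => [|p l IH] hl; first by rewrite big_nil; exact: graded_sum0.
rewrite big_cons; apply: graded_sumD; first by apply: hf (hl p (mem_head _ _)).
by apply: IH => q lq; apply: hl; rewrite inE lq orbT.
Qed.

End GradedSums.

Section LatticeOfWeights.
Variables (C : numFieldType) (k : nat) (V : vertexAlgebra C) (h e f : V).
Hypothesis HV : is_Lk0 k h e f.

(** A family of subsets stable, up to sums, under the modes of $h, e, f$ spans
    the algebra: the form in which the generation hypothesis is used. *)
Lemma generated_graded_sum (I : eqType) (B : I -> V -> Prop) :
  (forall i c x, B i x -> B i (c *: x)) ->
  graded_sum B (vacuum V) ->
  (forall i n x, B i x -> [/\ graded_sum B (va_mode h n x),
     graded_sum B (va_mode e n x) & graded_sum B (va_mode f n x)]) ->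
  forall x, graded_sum B x.
Proof.
move=> BZ Bvac Bmode; apply: (Lk0_generated HV) => //.
  split=> [|a x y Bx By]; first exact: graded_sum0.
  by apply: graded_sumD => //; apply: graded_sumZ.
by move=> n x Bx; split; apply: graded_sum_linear => // i y /Bmode By;
  have [] := By n.
Qed.

Let omega := omega_aff k h e f.

(** $[L(0), a_n] = (L(-1)a)_{n+1} + (L(0)a)_n$, and $L(-1)$ is the derivation. *)
Lemma weight_commutator (a : V) n u :
  va_mode omega 1 a = a ->
  va_mode omega 1 (va_mode a n u) = va_mode a n (va_mode omega 1 u) - n%:~R *: va_mode a n u.
Proof.
move=> wa; have [N hN] := @mode_commutator C V (adjoint_module V) omega a u 1 n.
have /= com := hN N.+2 (leqW (leqW (leqnn N))).
apply/eqP; rewrite addrC -subr_eq; apply/eqP; rewrite com.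
rewrite !big_ord_recl /= big1 => [|i _]; last by rewrite (@gbinom_nat C 1) // scale0r.
rewrite addr0 gbinom0 scale1r (_ : bump 0 0 = 1%N) // gbinom1 scale1r wa.
rewrite (voa_derivation (Lk0_voa HV)) (_ : 1 + n - 1 = n); last by rewrite addrC addKr.
by rewrite addr0 rmorphD /= opprD scalerDl scaleN1r !scaleNr addrAC addNr add0r.
Qed.

Lemma weight_h n u :
  va_mode omega 1 (va_mode h n u) = va_mode h n (va_mode omega 1 u) - n%:~R *: va_mode h n u.
Proof. by apply/weight_commutator/(sugawara_weight1 (Lk0_affine HV)); left. Qed.

Lemma weight_e n u :
  va_mode omega 1 (va_mode e n u) = va_mode e n (va_mode omega 1 u) - n%:~R *: va_mode e n u.
Proof. by apply/weight_commutator/(sugawara_weight1 (Lk0_affine HV)); right; left. Qed.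

Lemma weight_f n u :
  va_mode omega 1 (va_mode f n u) = va_mode f n (va_mode omega 1 u) - n%:~R *: va_mode f n u.
Proof. by apply/weight_commutator/(sugawara_weight1 (Lk0_affine HV)); right; right. Qed.

(** The Virasoro vectors of $V$ and of $K_0$ differ by that of the Heisenberg
    algebra, $h(-1)h/4k$, whose mode of index $1$ is a sum of products ending
    with some $h(m)$, $m \ge 0$. *)
Lemma K0_weight u : (0 < k)%N -> K0 h u ->
  va_mode (omega_K0 k h e f) 1 u = va_mode omega 1 u.
Proof.
move=> k0 Ku; have act := Lk0_affine HV.
have hh : va_mode (va_mode h (-1) h) 1 u = 0.
  have [N hN] := normal_product_mode1 h h u.
  rewrite (hN N) // big1 // => j _.
  by rewrite !Ku ?linear0 ?addr0.
have ef : va_mode f (-1) e = va_mode e (-1) f - va_mode h (-2) (vacuum V).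
  have := aff_ef act (-1) (-1) (vacuum V); rewrite !va_creation addr0 => <-.
  by rewrite opprB addrC subrK.
rewrite /omega /omega_aff /omega_K0 ef.
have kn0 : k%:R != 0 :> C by rewrite pnatr_eq0 -lt0n.
have k20 : k%:R + 2%:R != 0 :> C by rewrite -natrD pnatr_eq0 addn2.
rewrite ?(va_modeZl, va_modeDl, va_modeNl) hh.
rewrite !natrM natrD; module_eq C; field; by rewrite kn0 k20.
Qed.

End LatticeOfWeights.

(** * The operator Delta *)
Section TriangleSums.
Variable A : nmodType.
Implicit Type F : nat -> nat -> A.

Lemma sum_triangle_sym F n :
  \sum_(m < n) \sum_(i < n - m) F m i = \sum_(i < n) \sum_(m < n - i) F m i.
Proof.
have widen (G : nat -> nat -> A) : \sum_(m < n) \sum_(i < n - m) G m i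
    = \sum_(m < n) \sum_(i < n | (m + i < n)%N) G m i.
  apply: eq_bigr => m _; rewrite (big_ord_widen n (G m) (leq_subr m n)).
  by apply: eq_bigl => i; rewrite ltn_subRL.
rewrite widen (widen (fun i m => F m i)) (exchange_big_dep predT) //=.
by apply: eq_bigr => i _; apply: eq_bigl => m; rewrite addnC.
Qed.

Lemma sum_triangle_diag F n :
  \sum_(m < n) \sum_(i < n - m) F m i = \sum_(t < n) \sum_(m < t.+1) F m (t - m)%N.
Proof.
elim: n => [|n IH]; first by rewrite !big_ord0.
rewrite [RHS]big_ord_recr -IH big_ord_recr /= subSnn.
rewrite big_ord1 [X in _ = _ + X]big_ord_recr /= subnn addrA; congr (_ + _).
rewrite -big_split; apply: eq_bigr => m _ /=.
by rewrite subSn ?big_ord_recr // ltnW.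
Qed.

End TriangleSums.

Section Delta.
Variables (C : numFieldType) (V : vertexAlgebra C) (a : V).
Hypothesis a_comm : forall (m n : nat) u,
  va_mode a m.+1%:Z (va_mode a n.+1%:Z u) = va_mode a n.+1%:Z (va_mode a m.+1%:Z u).

Let c (m : nat) : C := (-1) ^+ m.+1 / - m.+1%:R.

Lemma delta_powS r p u : delta_pow a r.+1 p u
  = \sum_(m < p) c m *: va_mode a m.+1%:Z (delta_pow a r (p.-1 - m) u).
Proof.
rewrite /= big_add1 /= big_mkord; apply: eq_bigr => m _.
by case: p m => [[]|p m] //; rewrite subSS.
Qed.

Lemma delta_pow_linear r p : linear (delta_pow a r p).
Proof.
elim: r p => [|r IH] p b u u'; first by rewrite /=; case: eqP; rewrite ?scaler0 ?addr0.
rewrite !delta_powS scaler_sumr -big_split; apply: eq_bigr => m _ /=.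
by rewrite IH linearP scalerDr !scalerA mulrC.
Qed.

Lemma delta_pow_gt r p u : (p < r)%N -> delta_pow a r p u = 0.
Proof.
elim: r p => // r IH p ltpr; rewrite delta_powS big1 // => m _.
by rewrite IH ?linear0 ?scaler0 //; have := ltn_ord m; lia.
Qed.

Local Arguments delta_pow : simpl never.

(** Euler's operator $-z\,d/dz$ applied to $X^r$: as the $a(m)$ commute,
    $-z\,d/dz X^r = r (-z\,d/dz X) X^{r-1}$, and $-z\,d/dz X =
    \sum_m (-1)^m a(m+1) z^{-m-1}$. *)
Lemma delta_pow_derivation r p u : p%:R *: delta_pow a r p u
  = r%:R *: \sum_(m < p) (-1) ^+ m *: va_mode a m.+1%:Z (delta_pow a r.-1 (p.-1 - m) u).
Proof.
elim: r p => [|r IH] p.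
  by rewrite scale0r /delta_pow; case: eqP => [->|_]; rewrite ?scale0r ?scaler0.
have step : \sum_(m < p) ((p.-1 - m)%:R * c m) *: va_mode a m.+1%:Z (delta_pow a r (p.-1 - m) u)
   = r%:R *: \sum_(m < p) (-1) ^+ m *: va_mode a m.+1%:Z (delta_pow a r (p.-1 - m) u).
  case: p => [|p /=]; first by rewrite !big_ord0 scaler0.
  have eqm (m : nat) : ((p - m)%:R * c m) *: va_mode a m.+1%:Z (delta_pow a r (p - m) u)
    = r%:R *: \sum_(i < p - m) c m *: va_mode a m.+1%:Z
        ((-1) ^+ i *: va_mode a i.+1%:Z (delta_pow a r.-1 ((p - m).-1 - i) u)).
    rewrite mulrC -scalerA -[X in _ *: X = _]linearZ /= IH linearZ /= scalerA mulrC.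
    by rewrite -scalerA linear_sum scaler_sumr.
  under eq_bigr do rewrite eqm.
  rewrite -scaler_sumr; case: r {IH eqm} => [|r]; first by rewrite !scale0r.
  congr (_ *: _); rewrite big_ord_recr /= subnn big_ord0 addr0.
  rewrite [RHS]big_ord_recr /= subnn delta_powS big_ord0 linear0 scaler0 addr0.
  rewrite (sum_triangle_sym (fun m i => c m *: va_mode a m.+1%:Z
    ((-1) ^+ i *: va_mode a i.+1%:Z (delta_pow a r ((p - m).-1 - i) u)))).
  apply: eq_bigr => i _; rewrite delta_powS linear_sum scaler_sumr.
  apply: eq_bigr => m _ /=; rewrite !linearZ /= !scalerA mulrC a_comm.
  by do 3 congr (va_mode _ _ _) || congr (_ *: _); congr (delta_pow _ _ _ _); lia.
rewrite -natr1 scalerDl -step scale1r delta_powS scaler_sumr -big_split.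
apply: eq_bigr => m _ /=; rewrite !scalerA -scalerDl; congr (_ *: _).
have m0 : m.+1%:R != 0 :> C by rewrite pnatr_eq0.
have -> : p%:R = (p.-1 - m)%:R + m.+1%:R :> C.
  by rewrite -natrD; congr (_%:R); have := ltn_ord m; lia.
rewrite mulrDl; congr (_ + _); rewrite /c exprS; field.
by rewrite nat1r m0.
Qed.

Fact delta_exp_is_linear p : linear (delta_exp a p).
Proof.
move=> b u u'; rewrite /delta_exp scaler_sumr -big_split; apply: eq_bigr => r _ /=.
by rewrite delta_pow_linear scalerDr !scalerA mulrC.
Qed.

HB.instance Definition _ p :=
  GRing.isLinear.Build C V V *:%R (delta_exp a p) (delta_exp_is_linear p).

Lemma delta_exp0 u : delta_exp a 0 u = u.
Proof. by rewrite /delta_exp big_ord1 fact0 invr1 scale1r. Qed.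

(** The equation $-z\,d/dz \exp X = (-z\,d/dz X)\exp X$.  Since $p$ is invertible
    for $p > 0$, it determines $\exp X$ from its constant term, and it replaces
    the definition of [delta_exp] in all that follows. *)
Lemma delta_exp_rec p u : p%:R *: delta_exp a p u
  = \sum_(m < p) (-1) ^+ m *: va_mode a m.+1%:Z (delta_exp a (p.-1 - m) u).
Proof.
case: p => [|p /=]; first by rewrite big_ord0 scale0r.
rewrite /delta_exp scaler_sumr.
transitivity (\sum_(r < p.+1) (r`!)%:R^-1 *:
    \sum_(m < p.+1) (-1) ^+ m *: va_mode a m.+1%:Z (delta_pow a r (p - m) u)).
  rewrite big_ord_recl /= !scaler0 add0r; apply: eq_bigr => r _.
  rewrite scalerA mulrC -scalerA delta_pow_derivation /= scalerA /bump leq0n add1n.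
  congr (_ *: _); rewrite factS natrM invfM mulrC mulrA mulfV ?mul1r //.
  by rewrite pnatr_eq0.
under [LHS]eq_bigr do rewrite scaler_sumr.
rewrite exchange_big; apply: eq_bigr => m _ /=.
have lemp : ((p - m).+1 <= p.+1)%N by rewrite ltnS leq_subr.
rewrite (big_ord_widen _ (fun r => (r`!)%:R^-1 *: delta_pow a r (p - m) u) lemp).
rewrite [in RHS]big_mkcond linear_sum scaler_sumr; apply: eq_bigr => r _ /=.
case: ltnP => [_|gtr]; first by rewrite [in RHS]linearZ /= !scalerA mulrC.
by rewrite delta_pow_gt ?linear0 ?scaler0.
Qed.

(** The conjugation formula $\Delta(z) A(l) \Delta(z)^{-1} =
    (1 + S/z)^s A(l)$, where $S$ shifts the index $l$ by one.  Both sides solve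
    the first-order recursion [delta_exp_rec] in the power of $z^{-1}$. *)
Lemma delta_exp_mode (A : V) (s : C) p l u :
  (forall (m : nat) (n : int) v, va_mode a m.+1%:Z (va_mode A n v)
     = va_mode A n (va_mode a m.+1%:Z v) + s *: va_mode A (n + m.+1%:Z) v) ->
  delta_exp a p (va_mode A l u)
  = \sum_(i < p.+1) gbinom s i *: va_mode A (l + i%:Z) (delta_exp a (p - i) u).
Proof.
move=> comA; have [n] := ubnP p; elim: n p => // n IH [|p] ltpn.
  by rewrite big_ord1 !delta_exp0 gbinom0 scale1r addr0.
have p0 : p.+1%:R != 0 :> C by rewrite pnatr_eq0.
apply: (scalerI p0); rewrite delta_exp_rec /=.
pose D q := delta_exp a q u.
transitivity (\sum_(m < p.+1) \sum_(i < p.+1 - m) ((-1) ^+ m * gbinom s i) *: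
  (va_mode A (l + i%:Z) (va_mode a m.+1%:Z (D (p - m - i)%N))
   + s *: va_mode A (l + (i + m).+1%:Z) (D (p - m - i)%N))).
  apply: eq_bigr => m _; rewrite IH; last by have := ltn_ord m; lia.
  have -> : (p - m).+1 = (p.+1 - m)%N by have := ltn_ord m; lia.
  rewrite linear_sum scaler_sumr; apply: eq_bigr => i _ /=.
  rewrite linearZ /= comA scalerA; congr (_ *: (_ + _ *: va_mode _ _ _)).
  by rewrite -addrA -PoszD addnS.
transitivity (\sum_(m < p.+1) \sum_(i < p.+1 - m) ((-1) ^+ m * gbinom s i) *:
    va_mode A (l + i%:Z) (va_mode a m.+1%:Z (D (p - m - i)%N))
  + \sum_(m < p.+1) \sum_(i < p.+1 - m) ((-1) ^+ m * gbinom s i) *: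
    (s *: va_mode A (l + (i + m).+1%:Z) (D (p - m - i)%N))).
  rewrite -big_split; apply: eq_bigr => m _; rewrite -big_split.
  by apply: eq_bigr => i _; rewrite scalerDr.
rewrite (sum_triangle_sym (fun m i => ((-1) ^+ m * gbinom s i) *:
  va_mode A (l + i%:Z) (va_mode a m.+1%:Z (D (p - m - i)%N)))).
rewrite (sum_triangle_diag (fun m i => ((-1) ^+ m * gbinom s i) *:
  (s *: va_mode A (l + (i + m).+1%:Z) (D (p - m - i)%N)))).
have -> : \sum_(i < p.+1) \sum_(m < p.+1 - i) ((-1) ^+ m * gbinom s i) *:
  va_mode A (l + i%:Z) (va_mode a m.+1%:Z (D (p - m - i)%N))
  = \sum_(i < p.+2) ((p.+1 - i)%:R * gbinom s i) *: va_mode A (l + i%:Z) (D (p.+1 - i)%N).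
  rewrite [RHS]big_ord_recr /= subnn mul0r scale0r addr0; apply: eq_bigr => i _.
  rewrite [_ * gbinom _ _ in RHS]mulrC -scalerA -[X in _ = _ *: X]linearZ /= /D delta_exp_rec.
  rewrite linear_sum scaler_sumr; apply: eq_bigr => m _.
  rewrite [in RHS]linearZ /= scalerA mulrC.
  by congr (_ *: va_mode _ _ (va_mode _ _ (delta_exp a _ u))); lia.
have -> : \sum_(t < p.+1) \sum_(m < t.+1) ((-1) ^+ m * gbinom s (t - m)) *:
  (s *: va_mode A (l + (t - m + m).+1%:Z) (D (p - m - (t - m))%N))
  = \sum_(i < p.+2) (i%:R * gbinom s i) *: va_mode A (l + i%:Z) (D (p.+1 - i)%N).
  rewrite [RHS]big_ord_recl /= mul0r scale0r add0r; apply: eq_bigr => t _.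
  rewrite /bump leq0n add1n -gbinom_log_derivative mulr_sumr scaler_suml.
  apply: eq_bigr => m _; rewrite scalerA mulrC /=.
  have lemt : (m <= t)%N by rewrite -ltnS.
  by congr (_ *: va_mode _ _ (D _)); rewrite ?subnK //; lia.
rewrite -big_split scaler_sumr; apply: eq_bigr => i _ /=.
rewrite -scalerDl -mulrDl -natrD scalerA subnK //.
by have := ltn_ord i; lia.
Qed.

End Delta.

(** * Twisted modes *)
Section FiniteSupport.
Variables (T : choiceType) (A : nmodType).
Implicit Types f g : T -> A.

Definition finite_support f := exists r : seq T, forall q, q \notin r -> f q = 0.

Lemma finite_support_sumE f (r : seq T) : uniq r -> (forall q, q \notin r -> f q = 0) ->
  \sum_(q \in [set: T]) f q = \sum_(q <- r) f q.
Proof.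
move=> ur fr; rewrite (fsbigE r) // => [|q _]; last exact: fr.
by apply: eq_bigl => q; rewrite in_setT.
Qed.

Lemma finite_supportD f g : finite_support f -> finite_support g ->
  finite_support (fun q => f q + g q)
  /\ \sum_(q \in [set: T]) (f q + g q)
     = \sum_(q \in [set: T]) f q + \sum_(q \in [set: T]) g q.
Proof.
move=> [r hr] [r' hr']; pose s := undup (r ++ r').
have hs q : q \notin s -> f q = 0 /\ g q = 0.
  by rewrite mem_undup mem_cat negb_or => /andP[/hr-> /hr'->].
split; first by exists s => q /hs[-> ->]; rewrite addr0.
have us := undup_uniq (r ++ r').
rewrite !(@finite_support_sumE _ s) // => [|q /hs[]//|q /hs[]//|q /hs[-> ->]]; last first.
  by rewrite addr0.
by rewrite big_split.
Qed.

Lemma finite_support_sum (I : eqType) (l : seq I) (F : I -> T -> A) :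
  (forall i, i \in l -> finite_support (F i)) ->
  \sum_(q \in [set: T]) \sum_(i <- l) F i q
  = \sum_(i <- l) \sum_(q \in [set: T]) F i q.
Proof.
elim: l => [|i l IH] hl.
  by rewrite big_nil fsbig1 // => q _; rewrite big_nil.
have suppl : finite_support (fun q => \sum_(j <- l) F j q).
  elim: l hl {IH} => [|j l IH] hl; first by exists [::] => q _; rewrite big_nil.
  under eq_fun do rewrite big_cons.
  apply: (finite_supportD _ _).1; first by apply: hl; rewrite !inE eqxx orbT.
  by apply: IH => j' hj'; apply: hl; move: hj'; rewrite !inE => /predU1P[->|->];
    rewrite ?eqxx ?orbT.
under eq_fsbigr do rewrite big_cons.
rewrite (finite_supportD (hl i (mem_head _ _)) suppl).2 big_cons IH // => j lj.
by apply: hl; rewrite inE lj orbT.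
Qed.

End FiniteSupport.

Section TwistedModes.
Variables (C : numFieldType) (V : vertexAlgebra C) (M : vaModule V) (omega a : V).

(** The weight bounds the powers of $z^{-1}$ in $\Delta(a,z)u$ and the eigenvalue
    of $a(0)$ fixes the class of the indices of its nonzero modes; on such
    vectors the twisted mode is a plain finite sum. *)
Definition bihomogeneous (i : int * C) (u : V) :=
  weight_vector omega i.1 u /\ va_mode a 0 u = i.2 *: u.

Hypothesis a_comm : forall (m n : nat) u,
  va_mode a m%:Z (va_mode a n%:Z u) = va_mode a n%:Z (va_mode a m%:Z u).
Hypothesis a_weight : forall (n : int) u,
  va_mode omega 1 (va_mode a n u) = va_mode a n (va_mode omega 1 u) - n%:~R *: va_mode a n u.
Hypothesis bounded : exists n0 : int, forall (n : int) (u : V),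
  n < n0 -> weight_vector omega n u -> u = 0.
Hypothesis all_bihomogeneous : forall u, graded_sum bihomogeneous u.

Let delta_rec := delta_exp_rec (fun m n u => a_comm m.+1 n.+1 u).

Lemma delta_exp_bihomogeneous d t p u :
  bihomogeneous (d, t) u -> bihomogeneous (d - p%:Z, t) (delta_exp a p u).
Proof.
move=> hu; have [n] := ubnP p; elim: n p => // n IH [|p] ltpn.
  by rewrite delta_exp0 subr0.
have p0 : p.+1%:R != 0 :> C by rewrite pnatr_eq0.
split; apply: (scalerI p0) => /=.
  rewrite /weight_vector -linearZ /= scalerA mulrC -scalerA delta_rec linear_sum scaler_sumr.
  apply: eq_bigr => m _ /=; have ltm := ltn_ord m.
  have [wm _] : bihomogeneous (d - (p - m)%N%:Z, t) (delta_exp a (p - m) u).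
    by apply: IH; lia.
  rewrite linearZ /= a_weight wm linearZ /= -scalerBl !scalerA mulrC; congr (_ * _ *: _).
  by rewrite -rmorphB; congr (_%:~R); lia.
rewrite -linearZ /= scalerA mulrC -scalerA delta_rec linear_sum scaler_sumr.
apply: eq_bigr => m _ /=; have ltm := ltn_ord m.
have [_ am] : bihomogeneous (d - (p - m)%N%:Z, t) (delta_exp a (p - m) u).
  by apply: IH; lia.
by rewrite linearZ /= (a_comm 0) am linearZ /= !scalerA mulrC.
Qed.

(** The coefficient of $z^{-p}$ in $\Delta(a,z)u$ has weight $d - p$, and the
    weights are bounded below. *)
Lemma delta_exp_truncated i u : bihomogeneous i u ->
  exists Q : nat, forall p, (Q <= p)%N -> delta_exp a p u = 0.
Proof.
case: i => d t hu; have [n0 hn0] := bounded; exists `|d - n0|.+1%N => p leQp.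
by apply: (hn0 (d - p%:Z)); [lia|have [] := delta_exp_bihomogeneous p hu].
Qed.

Let summand u (n : rat) (w : M) (q : int * nat) : M :=
  mod_mode (eigen_component (va_mode a 0) (ratr (q.1%:~R - n + q.2%:R))
         (delta_exp a q.2 u)) q.1 w.

Lemma twisted_mode_summand i u n (w : M) q : bihomogeneous i u ->
  summand u n w q = if (q.1 + q.2%:Z)%:~R == ratr n + i.2
                    then mod_mode (delta_exp a q.2 u) q.1 w else 0.
Proof.
case: i => d t hu; have [_ /= hd] := delta_exp_bihomogeneous q.2 hu.
have := @eigen_componentE C V (va_mode a 0) [:: (t, delta_exp a q.2 u)]
  (ratr (q.1%:~R - n + q.2%:R)).
rewrite /summand big_seq1 big_mkcond big_seq1 /= => ->.
  rewrite rmorphD rmorphB /= ratr_int ratr_nat rmorphD /= -pmulrn.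
  rewrite [t == _]eq_sym addrAC subr_eq addrC [ratr n + t]addrC.
  by case: eqP => // _; rewrite mode0l.
by move=> p; rewrite inE => /eqP->.
Qed.

Lemma summand_eq0 i u n (w : M) (z : int) (Q : nat) q : bihomogeneous i u ->
  z%:~R = ratr n + i.2 -> (forall p, (Q <= p)%N -> delta_exp a p u = 0) ->
  q \notin [seq (z - p%:Z, p) | p <- iota 0 Q] -> summand u n w q = 0.
Proof.
move=> hu zE hQ; rewrite (twisted_mode_summand _ _ _ hu); case: eqP => // qE.
have [ltQ|geQ] := ltnP q.2 Q; last by rewrite hQ // mode0l.
case/mapP; exists q.2; first by rewrite mem_iota.
move: qE; rewrite -zE => /intr_inj <-.
by rewrite addrK; case: q {ltQ}.
Qed.

Lemma twisted_mode_finite_support i u n (w : M) : bihomogeneous i u ->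
  finite_support (summand u n w).
Proof.
move=> hu; have [Q hQ] := delta_exp_truncated hu.
have [[z zE]|noz] := pselect (exists z : int, z%:~R = ratr n + i.2 :> C).
  exists [seq (z - p%:Z, p) | p <- iota 0 Q] => q; exact: summand_eq0 hu zE hQ.
exists [::] => q _; rewrite (twisted_mode_summand _ _ _ hu).
by case: eqP => // zE; case: noz; exists (q.1 + q.2%:Z).
Qed.

Lemma twisted_mode_integral i u n (w : M) (z : int) (Q : nat) :
  bihomogeneous i u -> z%:~R = ratr n + i.2 ->
  (forall p, (Q <= p)%N -> delta_exp a p u = 0) ->
  twisted_mode a u n w = \sum_(p < Q) mod_mode (delta_exp a p u) (z - p%:Z) w.
Proof.
move=> hu zE hQ; rewrite /twisted_mode -/(summand u n w).
rewrite (@finite_support_sumE _ _ _ [seq (z - p%:Z, p) | p <- iota 0 Q]).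
- rewrite big_map -{1}[Q]subn0 -/(index_iota 0 Q) big_mkord.
  apply: eq_bigr => p _; rewrite -/(summand u n w (z - p%:Z, p : nat)).
  by rewrite (twisted_mode_summand _ _ _ hu) /= subrK zE eqxx.
- by rewrite map_inj_uniq ?iota_uniq // => p p' [].
by move=> q; exact: summand_eq0 hu zE hQ.
Qed.

Lemma twisted_mode_nonintegral i u n (w : M) :
  bihomogeneous i u -> (forall z : int, z%:~R <> ratr n + i.2 :> C) ->
  twisted_mode a u n w = 0.
Proof.
move=> hu noz; rewrite /twisted_mode fsbig1 // => q _.
by rewrite -/(summand u n w q) (twisted_mode_summand _ _ _ hu); case: eqP => // /noz.
Qed.

Lemma twisted_mode_graded_sum (l : seq (int * C * V)) n (w : M) :
  (forall p, p \in l -> bihomogeneous p.1 p.2) ->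
  twisted_mode a (\sum_(p <- l) p.2) n w = \sum_(p <- l) twisted_mode a p.2 n w.
Proof.
move=> hl; rewrite /twisted_mode -(@finite_support_sum _ _ _ l (fun p => summand p.2 n w)).
  apply: eq_fsbigr => q _; rewrite /summand; set s := ratr _.
  rewrite -mode_suml; congr (mod_mode _ _ _); rewrite linear_sum.
  have hd p : p \in l -> va_mode a 0 (delta_exp a q.2 p.2) = p.1.2 *: delta_exp a q.2 p.2.
    by case: p => [[d t] x] /hl /(delta_exp_bihomogeneous q.2)[].
  have := @eigen_componentE C V (va_mode a 0) [seq (p.1.2, delta_exp a q.2 p.2) | p <- l] s.
  rewrite !big_map /= => -> => [|_ /mapP[p /hd lp ->]//].
  rewrite big_mkcond; apply: eq_big_seq => p lp.
  have := @eigen_componentE C V (va_mode a 0) [:: (p.1.2, delta_exp a q.2 p.2)] s.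
  rewrite big_seq1 big_mkcond big_seq1 /= => -> // p'; rewrite inE => /eqP-> /=.
  exact: hd.
by move=> p /hl; exact: twisted_mode_finite_support.
Qed.

(** Not immediate from the definition, since eigencomponents are chosen vectors
    and sums over infinite sets are additive only for finite supports; both
    are controlled on bihomogeneous vectors, which span. *)
Lemma twisted_mode_linear n (w : M) : linear (fun u => twisted_mode a u n w).
Proof.
move=> c u u'; have [[l [hl ->]] [l' [hl' ->]]] := (all_bihomogeneous u, all_bihomogeneous u').
have hZ i x : bihomogeneous i x -> bihomogeneous i (c *: x).
  by move=> [h1 h2]; split; rewrite /weight_vector linearZ /= (h1, h2) !scalerA mulrC.
have -> : c *: (\sum_(p <- l) p.2) + \sum_(p <- l') p.2
    = \sum_(p <- [seq (p.1, c *: p.2) | p <- l] ++ l') p.2.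
  by rewrite big_cat big_map scaler_sumr.
rewrite !twisted_mode_graded_sum // => [|p]; last first.
  by rewrite mem_cat => /orP[/mapP[q /hl lq ->]|/hl'//]; apply: hZ.
rewrite big_cat big_map scaler_sumr; congr (_ + _); apply: eq_big_seq => p /hl hp /=.
have [Q hQ] := delta_exp_truncated hp.
have [[z zE]|noz] := pselect (exists z : int, z%:~R = ratr n + p.1.2 :> C); last first.
  rewrite !(@twisted_mode_nonintegral p.1) ?scaler0 //; try exact: hZ.
  - by move=> z zE; apply: noz; exists z.
  - by move=> z zE; apply: noz; exists z.
rewrite !(@twisted_mode_integral p.1 _ _ _ z Q) //; last first.
- by move=> j leQj; rewrite linearZ /= hQ ?scaler0.
- exact: hZ.
by rewrite scaler_sumr; apply: eq_bigr => j _; rewrite linearZ /= modeZl.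
Qed.



Lemma uniform_bound (P : nat -> nat -> Prop) (Q : nat) :
  (forall q, exists N0, forall N, (N0 <= N)%N -> P q N) ->
  exists N0, forall N, (N0 <= N)%N -> forall q, (q < Q)%N -> P q N.
Proof.
move=> hP; elim: Q => [|Q [N1 h1]]; first by exists 0%N.
have [N2 h2] := hP Q; exists (N1 + N2)%N => N leN q; rewrite ltnS leq_eqVlt.
by case/predU1P => [->|]; [apply: h2|apply: h1]; lia.
Qed.

Lemma twisted_mode_linear_r u n : linear (twisted_mode a u n : M -> M).
Proof.
have [l [hl ->]] := all_bihomogeneous u; move=> c x y.
rewrite !twisted_mode_graded_sum // scaler_sumr -big_split; apply: eq_big_seq => p /hl hp /=.
have [[z zE]|noz] := pselect (exists z : int, z%:~R = ratr n + p.1.2 :> C); last first.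
  rewrite !(@twisted_mode_nonintegral p.1) ?scaler0 ?addr0 // => z zE; apply: noz; by exists z.
have [Q hQ] := delta_exp_truncated hp.
rewrite !(@twisted_mode_integral p.1 _ _ _ z Q) // scaler_sumr -big_split.
by apply: eq_bigr => j _; rewrite linearP.
Qed.

Lemma delta_exp_vacuum p : (0 < p)%N -> delta_exp a p (vacuum V) = 0.
Proof.
have [n] := ubnP p; elim: n p => // n IH [|p] // ltpn _.
have p0 : p.+1%:R != 0 :> C by rewrite pnatr_eq0.
apply: (scalerI p0); rewrite delta_rec scaler0 big1 // => m _ /=.
have [->|pm] := eqVneq (p - m)%N 0%N; first by rewrite delta_exp0 va_creation0 ?scaler0.
by rewrite IH ?linear0 ?scaler0 //; lia.
Qed.

Lemma bihomogeneous_vacuum : bihomogeneous (0, 0) (vacuum V).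
Proof. by split; rewrite /weight_vector va_creation0 //= scale0r. Qed.

Lemma twisted_mode_vacuum n (x : M) :
  twisted_mode a (vacuum V) n x = if n == -1 then x else 0.
Proof.
have [[z zE]|noz] := pselect (exists z : int, z%:~R = ratr n + 0 :> C); last first.
  rewrite (twisted_mode_nonintegral _ bihomogeneous_vacuum) /=; last first.
    by move=> z zE; apply: noz; exists z.
  case: eqP => // nE; case: noz; exists (-1).
  by rewrite nE addr0 rmorphN1 rmorphN1.
rewrite (@twisted_mode_integral _ _ _ _ z 1 bihomogeneous_vacuum) // => [|p]; last first.
  by move=> p1; rewrite delta_exp_vacuum.
rewrite big_ord1 delta_exp0 mod_vacuum subr0.
have -> : n = z%:~R.
  by apply: (fmorph_inj (ratr : rat -> C)); rewrite -[LHS]addr0 -zE /= ratr_int.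
by rewrite -[-1 in RHS](rmorphN1 (intr : int -> rat)) eqr_int.
Qed.

Section TwistedBorcherds.
Variables (A : V) (s : C) (m' : int).
Hypothesis A_eigen : forall (m : nat) (n : int) v, va_mode a m%:Z (va_mode A n v)
     = va_mode A n (va_mode a m%:Z v) + s *: va_mode A (n + m%:Z) v.
Hypothesis A_weight : forall (n : int) u,
  va_mode omega 1 (va_mode A n u) = va_mode A n (va_mode omega 1 u) - n%:~R *: va_mode A n u.
Hypothesis m'E : m'%:~R = 2%:R^-1 + s :> C.

Lemma bihomogeneous_mode d t n u :
  bihomogeneous (d, t) u -> bihomogeneous (d - n, t + s) (va_mode A n u).
Proof.
move=> [/= wu au]; split; rewrite /weight_vector /=.
  by rewrite A_weight wu linearZ /= -scalerBl rmorphB.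
by rewrite (A_eigen 0) au addr0 linearZ /= -scalerDl.
Qed.

(** The Borcherds identity for the twisted modes of $A$ and $u$, at the exponent
    $m = 1/2$ of $A$.  As $A$ has eigenvalue $s$ for $a(0)$, its twisted mode of
    index $n$ is the untwisted mode of index $n + s$, and $m' = 1/2 + s$.  On the
    left, expanding $\Delta(a,z)A(l+j)u$ by [delta_exp_mode] produces the
    coefficients $\binom{1/2}{j}\binom{s}{i}$, which the Vandermonde convolution
    collects into those of the untwisted identity with exponent $m'$, applied
    to $A$ and each coefficient of $\Delta(a,z)u$. *)
Lemma twisted_borcherds i u (x : M) (l : int) (n : rat) : bihomogeneous i u ->
  exists N0 : nat, forall N, (N0 <= N)%N ->
  \sum_(j < N) gbinom (2%:R^-1 : C) j *:
     twisted_mode a (va_mode A (l + j%:Z) u) (2%:R^-1 + n - j%:R) x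
  = \sum_(j < N) ((-1) ^+ j * gbinom (l%:~R : C) j) *:
     (mod_mode A (l + m' - j%:Z) (twisted_mode a u (n + j%:R) x)
      - (-1) ^ l *: twisted_mode a u (l%:~R + n - j%:R) (mod_mode A (m' + j%:Z) x)).
Proof.
case: i => d t hu.
have hA j : bihomogeneous (d - (l + j%:Z), t + s) (va_mode A (l + j%:Z) u).
  exact: bihomogeneous_mode.
have half : ratr 2%:R^-1 = 2%:R^-1 :> C by rewrite fmorphV /= ratr_nat.
have [[z zE]|noz] := pselect (exists z : int, z%:~R = ratr n + t :> C); last first.
  exists 0%N => N _; rewrite !big1 // => j _.
    rewrite !(twisted_mode_nonintegral _ hu) ?linear0 ?addr0 ?scaler0 // => z.
      rewrite rmorphB rmorphD /= ratr_int ratr_nat => zE; apply: noz; exists (z - l + j%:Z).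
      by rewrite rmorphD rmorphB /= zE -pmulrn; ring.
    rewrite rmorphD /= ratr_nat => zE; apply: noz; exists (z - j%:Z).
    by rewrite rmorphB /= zE -pmulrn; ring.
  rewrite (twisted_mode_nonintegral _ (hA j)) ?scaler0 // => z.
  rewrite rmorphB rmorphD /= ratr_nat half => zE; apply: noz; exists (z - m' + j%:Z).
  by rewrite rmorphD rmorphB /= zE m'E -pmulrn; ring.
have [Q hQ] := delta_exp_truncated hu; pose D q := delta_exp a q u.
have [N0 hN0] : exists N0, forall N, (N0 <= N)%N -> forall q, (q < Q)%N ->
   (forall j, (N <= j)%N -> va_mode A (l + j%:Z) (D q) = 0) /\
   \sum_(j < N) gbinom (m'%:~R : C) j *:
        mod_mode (va_mode A (l + j%:Z) (D q)) (m' + (z - q%:Z) - j%:Z) x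
    = \sum_(j < N) ((-1) ^+ j * gbinom (l%:~R : C) j) *:
        (mod_mode A (l + m' - j%:Z) (mod_mode (D q) (z - q%:Z + j%:Z) x)
         - (-1) ^ l *: mod_mode (D q) (l + (z - q%:Z) - j%:Z) (mod_mode A (m' + j%:Z) x)).
  apply: (uniform_bound (P := fun q N => _ /\ _)) => q.
  have [N1 h1] := mode_borcherds_from A (D q) x l m' (z - q%:Z).
  have [N2 h2] := va_mode_truncated A (D q) l.
  exists (N1 + N2)%N => N leN; split; last by apply: h1; lia.
  by move=> j lej; apply: h2; lia.
exists N0 => N leN; have hN q ltq := hN0 N leN q ltq.
have vanish j q : (N <= j)%N || (Q <= q)%N -> va_mode A (l + j%:Z) (D q) = 0.
  have [ltq|leq] := ltnP q Q; last by rewrite /D hQ ?linear0.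
  by rewrite orbF => /(hN q ltq).1.
transitivity (\sum_(q < Q) \sum_(j < N) gbinom (m'%:~R : C) j *:
        mod_mode (va_mode A (l + j%:Z) (D q)) (m' + (z - q%:Z) - j%:Z) x); last first.
  under eq_bigr => q _ do rewrite (hN q (ltn_ord q)).2.
  rewrite exchange_big; apply: eq_bigr => j _ /=; rewrite -scaler_sumr; congr (_ *: _).
  rewrite sumrB -scaler_sumr -linear_sum; congr (mod_mode _ _ _ - _ *: _).
    rewrite (@twisted_mode_integral (d, t) _ _ _ (z + j%:Z) Q) //.
      by apply: eq_bigr => q _; rewrite addrAC.
    by rewrite rmorphD /= zE rmorphD /= ratr_nat -pmulrn addrAC.
  rewrite (@twisted_mode_integral (d, t) _ _ _ (l + z - j%:Z) Q) //.
    by apply: eq_bigr => q _; congr (mod_mode _ _ _); lia.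
  by rewrite rmorphB rmorphD /= zE rmorphB rmorphD /= ratr_nat ratr_int -pmulrn; ring.
(* The terms on the left depend on $i$ and $j$, apart from their coefficients,
   only through $i + j$. *)
pose g j := \sum_(q < Q) mod_mode (va_mode A (l + j%:Z) (D q)) (m' + (z - q%:Z) - j%:Z) x.
have g0 j : (N <= j)%N -> g j = 0.
  by move=> leNj; rewrite /g big1 // => q _; rewrite vanish ?leNj // mode0l.
transitivity (\sum_(j < N) \sum_(i < N) (gbinom 2%:R^-1 j * gbinom s i) *: g (j + i)%N).
  apply: eq_bigr => j _.
  have deltaA p : delta_exp a p (va_mode A (l + j%:Z) u)
      = \sum_(i < p.+1) gbinom s i *: va_mode A (l + (j + i)%N%:Z) (D (p - i)%N).
    rewrite (@delta_exp_mode _ _ _ (fun m n u => a_comm m.+1 n.+1 u) A s) //.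
    by apply: eq_bigr => i _; rewrite PoszD addrA.
  rewrite (@twisted_mode_integral _ _ _ _ (m' + z - j%:Z) (N + Q) (hA j)); last first.
  - move=> p leNQ; rewrite deltaA big1 // => i _; rewrite vanish ?scaler0 //.
    by have := ltn_ord i; lia.
  - rewrite rmorphB rmorphD /= m'E zE rmorphB rmorphD /= ratr_nat half -pmulrn /=; ring.
  under eq_bigr => p _ do rewrite deltaA mode_suml.
  have := @sum_convolution M (fun i q => mod_mode (gbinom s i *: va_mode A (l + (j + i)%N%:Z) (D q))
     (m' + z - j%:Z - (i + q)%N%:Z) x) N Q (N + Q) (leqnn _).
  move=> conv; rewrite [X in _ *: X](_ : _ = \sum_(i < N) gbinom s i *: g (j + i)%N).
    by rewrite scaler_sumr; apply: eq_bigr => i _; rewrite scalerA.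
  transitivity (\sum_(p < N + Q) \sum_(i < p.+1)
     mod_mode (gbinom s i *: va_mode A (l + (j + i)%N%:Z) (D (p - i)%N))
     (m' + z - j%:Z - (i + (p - i))%N%:Z) x).
    apply: eq_bigr => p _; apply: eq_bigr => i _; rewrite subnKC //.
    by rewrite -ltnS.
  rewrite conv => [|i q leNQ]; last first.
    by rewrite vanish ?scaler0 ?mode0l //; lia.
  apply: eq_bigr => i _; rewrite /g scaler_sumr; apply: eq_bigr => q _.
  by rewrite modeZl; congr (_ *: mod_mode _ _ _); lia.
rewrite -(@sum_convolution M (fun j i => (gbinom 2%:R^-1 j * gbinom s i) *: g (j + i)%N) N N (N + N)) //.
  rewrite exchange_big /= (eq_bigr (fun j : 'I_N => gbinom m'%:~R j *: g j)).
    rewrite big_split_ord /= [X in _ + X]big1 ?addr0.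
      apply: eq_bigr => j _; rewrite m'E -gbinom_vandermonde scaler_suml.
      by apply: eq_bigr => i _; rewrite subnKC // -ltnS.
    by move=> j _; rewrite big1 // => i _; rewrite subnKC ?g0 ?scaler0 ?leq_addr // -ltnS.
  by move=> j _; rewrite scaler_sumr.
by move=> i q leN'; rewrite g0 ?scaler0 //; lia.
Qed.

(** $A = A(-1)1$ and $a(m)A = s A(m-1)1 = 0$ for $m > 0$. *)
Lemma delta_exp_generator p : (0 < p)%N -> delta_exp a p A = 0.
Proof.
move=> p0; rewrite -{1}[A]va_creation.
rewrite (@delta_exp_mode _ _ _ (fun m n u => a_comm m.+1 n.+1 u) A s) //.
rewrite big1 // => i _; have [->|ip] := eqVneq (i : nat) p.
  by rewrite subnn delta_exp0 va_creation0 ?scaler0 //; lia.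
rewrite delta_exp_vacuum ?linear0 ?scaler0 //.
by have := ltn_ord i; lia.
Qed.

Lemma twisted_mode_generator n (z : int) (x : M) : 
  z%:~R = ratr n + s :> C -> twisted_mode a A n x = mod_mode A z x.
Proof.
move=> zE; have hA : bihomogeneous (0 - -1, 0 + s) A.
  by rewrite -[A]va_creation; apply/bihomogeneous_mode/bihomogeneous_vacuum.
rewrite (@twisted_mode_integral _ _ _ _ z 1 hA) /= ?add0r // => [|p p1].
  by rewrite big_ord1 delta_exp0 subr0.
exact: delta_exp_generator.
Qed.

Lemma twisted_borcherds_all u (x : M) (l : int) (n : rat) :
  exists N0 : nat, forall N, (N0 <= N)%N ->
  \sum_(j < N) gbinom (2%:R^-1 : C) j *:
     twisted_mode a (va_mode A (l + j%:Z) u) (2%:R^-1 + n - j%:R) x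
  = \sum_(j < N) ((-1) ^+ j * gbinom (l%:~R : C) j) *:
     (mod_mode A (l + m' - j%:Z) (twisted_mode a u (n + j%:R) x)
      - (-1) ^ l *: twisted_mode a u (l%:~R + n - j%:R) (mod_mode A (m' + j%:Z) x)).
Proof.
have T0 r y : twisted_mode a 0 r y = 0 :> M.
  have := @twisted_mode_linear r y (-1) 0 0.
  by rewrite scaler0 addr0 scaleN1r addNr.
have TD u1 u2 r y : twisted_mode a (u1 + u2) r y = twisted_mode a u1 r y + twisted_mode a u2 r y :> M.
  by have := @twisted_mode_linear r y 1 u1 u2; rewrite !scale1r.
have [lst [hl ->]] := all_bihomogeneous u; elim: lst hl => [|p lst IH] hl.
  exists 0%N => N _; rewrite big_nil !big1 // => j _.
    by rewrite !T0 linear0 scaler0 subr0 scaler0.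
  by rewrite linear0 T0 scaler0.
have [N1 h1] := twisted_borcherds x l n (hl p (mem_head _ _)).
have [|N2 h2] := IH; first by move=> q lq; apply: hl; rewrite inE lq orbT.
exists (N1 + N2)%N => N leN; rewrite big_cons.
transitivity (\sum_(j < N) gbinom (2%:R^-1 : C) j *:
     twisted_mode a (va_mode A (l + j%:Z) p.2) (2%:R^-1 + n - j%:R) x
   + \sum_(j < N) gbinom (2%:R^-1 : C) j *:
     twisted_mode a (va_mode A (l + j%:Z) (\sum_(q <- lst) q.2)) (2%:R^-1 + n - j%:R) x).
  by rewrite -big_split; apply: eq_bigr => j _; rewrite linearD TD scalerDr.
rewrite h1 ?h2; [|lia|lia]; rewrite -big_split; apply: eq_bigr => j _ /=.
by rewrite -scalerDr; congr (_ *: _); rewrite !TD linearD scalerDr opprD addrACA.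
Qed.

End TwistedBorcherds.

End TwistedModes.

(** * The bigraded space generated by the lowest vector *)
Section TwistedFock.
Variables (C : numFieldType) (k : nat) (M : lmodType C).
Variables (H E F : int -> {linear M -> M}).
Hypothesis act : affine_sl2_action k H E F.

(** The twisted modes $h_{t-1/2}$, $(e-f)_{t-1/2}$ and $(e+f)_t$ when $H, E, F$ is
    the rotated triple; the constant $k/2$ comes from $h''(1)H = (k/2)1$. *)
Definition odd_plus (t : int) (x : M) : M := E t x + F (t - 1) x.
Definition odd_minus (t : int) (x : M) : M := F (t - 1) x - E t x.
Definition even_mode (t : int) (x : M) : M :=
  H t x + (if t == 0 then (2%:R^-1 * k%:R) *: x else 0).

Fact odd_plus_is_linear t : linear (odd_plus t).
Proof. by move=> c x y; rewrite /odd_plus !linearP /=; module_eq C; ring. Qed.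
HB.instance Definition _ t := GRing.isLinear.Build C M M *:%R (odd_plus t) (odd_plus_is_linear t).

Fact odd_minus_is_linear t : linear (odd_minus t).
Proof. by move=> c x y; rewrite /odd_minus !linearP /=; module_eq C; ring. Qed.
HB.instance Definition _ t := GRing.isLinear.Build C M M *:%R (odd_minus t) (odd_minus_is_linear t).

Fact even_mode_is_linear t : linear (even_mode t).
Proof.
by move=> c x y; rewrite /even_mode !linearP /=; case: eqP => _; module_eq C; field.
Qed.
HB.instance Definition _ t := GRing.isLinear.Build C M M *:%R (even_mode t) (even_mode_is_linear t).

Section Commutators.

Let eqn (x y z : M) : x - y = z -> x = y + z.
Proof. by move=> <-; rewrite addrC subrK. Qed.
Let hh m n w := eqn (aff_hh act m n w).
Let he m n w := eqn (aff_he act m n w).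
Let hf m n w := eqn (aff_hf act m n w).
Let ef m n w := eqn (aff_ef act m n w).
Let ee m n w := aff_ee act m n w.
Let ff m n w := aff_ff act m n w.

Let tuP (t u : int) : t + u = 1 -> u = 1 - t.
Proof. by move<-; rewrite addrC addKr. Qed.

Lemma odd_plus_odd_plus t u x : odd_plus t (odd_plus u x) = odd_plus u (odd_plus t x)
  + (if t + u == 1 then ((t - u)%:~R * k%:R) *: x else 0).
Proof.
rewrite /odd_plus !linearD /= (ee t u) (ff (t - 1) (u - 1)) (ef t (u - 1)) (ef u (t - 1)).
rewrite (_ : u + (t - 1) = t + (u - 1)); last by ring.
rewrite (_ : (t + (u - 1) == 0) = (t + u == 1)); last by apply/eqP/eqP; lia.
case: eqP => [/tuP->|_]; rewrite ?rmorphB; by module_eq C; ring.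
Qed.

Lemma odd_minus_odd_minus t u x : odd_minus t (odd_minus u x) = odd_minus u (odd_minus t x)
  + (if t + u == 1 then ((u - t)%:~R * k%:R) *: x else 0).
Proof.
rewrite /odd_minus !linearB /= (ee t u) (ff (t - 1) (u - 1)) (ef t (u - 1)) (ef u (t - 1)).
rewrite (_ : u + (t - 1) = t + (u - 1)); last by ring.
rewrite (_ : (t + (u - 1) == 0) = (t + u == 1)); last by apply/eqP/eqP; lia.
case: eqP => [/tuP->|_]; rewrite ?rmorphB; by module_eq C; ring.
Qed.

Lemma odd_plus_odd_minus t u x : odd_plus t (odd_minus u x)
  = odd_minus u (odd_plus t x) + 2%:R *: even_mode (t + u - 1) x.
Proof.
rewrite /odd_minus /odd_plus /even_mode !linearB !linearD /= (ee t u) (ff (t - 1) (u - 1)).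
rewrite (ef t (u - 1)) (ef u (t - 1)).
rewrite !addrA [u + t]addrC.
rewrite subr_eq0.
case: eqP => [/tuP->|_]; rewrite ?rmorphB; by module_eq C; field.
Qed.

Lemma even_mode_odd_plus t u x : even_mode t (odd_plus u x)
  = odd_plus u (even_mode t x) - 2%:R *: odd_minus (t + u) x.
Proof.
rewrite /odd_minus /odd_plus /even_mode !linearD /= (he t u) (hf t (u - 1)) [t + (u - 1)]addrA.
by case: eqP => _; rewrite ?linear0 ?linearZ /=; module_eq C; field.
Qed.

Lemma even_mode_odd_minus t u x : even_mode t (odd_minus u x)
  = odd_minus u (even_mode t x) - 2%:R *: odd_plus (t + u) x.
Proof.
rewrite /odd_minus /odd_plus /even_mode !linearD /= linearN /= (he t u) (hf t (u - 1)) [t + (u - 1)]addrA.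
by case: eqP => _; rewrite ?linear0 ?linearZ /=; module_eq C; field.
Qed.

Lemma even_mode_even_mode t u x : even_mode t (even_mode u x)
  = even_mode u (even_mode t x) + (if t + u == 0 then ((2 * t)%:~R * k%:R) *: x else 0).
Proof.
rewrite /even_mode !linearD /= (hh t u).
by case: (u =P 0) => _; case: (t =P 0) => _; case: (t + u =P 0) => _;
  rewrite ?linear0 ?linearZ /=; module_eq C; field.
Qed.

End Commutators.

Variable eta : M.
Hypothesis E_eta : forall t : int, 1 <= t -> E t eta = 0.
Hypothesis F_eta : forall t : int, 0 <= t -> F t eta = 0.
Hypothesis H_eta : forall t : int, 1 <= t -> H t eta = 0.
Hypothesis H0_eta : H 0 eta = - (2%:R^-1 * k%:R) *: eta.

(** The part of degree $r$ and parity $b$ of the space generated by [eta] under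
    modes that raise the degree.  Only raising modes are constructors, so
    that nothing nonzero has negative degree by construction; stability under all
    modes is then the commutation argument of [twisted_space_modes]. *)
Inductive twisted_space : rat -> bool -> M -> Prop :=
  | TwistedZero r b : twisted_space r b 0
  | TwistedLinear r b c x y : twisted_space r b x -> twisted_space r b y ->
      twisted_space r b (c *: x + y)
  | TwistedEta : twisted_space 0 false eta
  | TwistedOddPlus r b (t : int) x : t <= 0 -> twisted_space r b x ->
      twisted_space (r - (t%:~R - 2%:R^-1)) b (odd_plus t x)
  | TwistedOddMinus r b (t : int) x : t <= 0 -> twisted_space r b x ->
      twisted_space (r - (t%:~R - 2%:R^-1)) (~~ b) (odd_minus t x)
  | TwistedEven r b (t : int) x : t < 0 -> twisted_space r b x ->
      twisted_space (r - t%:~R) (~~ b) (even_mode t x).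

Lemma twisted_space_cast r b r' b' x :
  twisted_space r b x -> r = r' -> b = b' -> twisted_space r' b' x.
Proof. by move=> ? <- <-. Qed.

Lemma twisted_spaceZ r b c x : twisted_space r b x -> twisted_space r b (c *: x).
Proof. by move=> Tx; rewrite -[_ *: _]addr0; apply: TwistedLinear => //; constructor. Qed.

Lemma twisted_spaceD r b x y :
  twisted_space r b x -> twisted_space r b y -> twisted_space r b (x + y).
Proof. by move=> Tx Ty; rewrite -[x]scale1r; apply: TwistedLinear. Qed.

Lemma twisted_spaceB r b x y :
  twisted_space r b x -> twisted_space r b y -> twisted_space r b (x - y).
Proof. by move=> Tx Ty; rewrite addrC -scaleN1r; apply: TwistedLinear. Qed.

Lemma twisted_space_sum (I : Type) (l : seq I) (P : pred I) (f : I -> M) r b :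
  (forall i, P i -> twisted_space r b (f i)) -> twisted_space r b (\sum_(i <- l | P i) f i).
Proof.
by move=> hf; apply: big_ind => //; [constructor|apply: twisted_spaceD].
Qed.

Lemma odd_plus_eta t : 1 <= t -> odd_plus t eta = 0.
Proof. by move=> t1; rewrite /odd_plus E_eta ?F_eta ?addr0 ?subr_ge0. Qed.

Lemma odd_minus_eta t : 1 <= t -> odd_minus t eta = 0.
Proof. by move=> t1; rewrite /odd_minus E_eta ?F_eta ?subr0 ?subr_ge0. Qed.

Lemma even_mode_eta t : 0 <= t -> even_mode t eta = 0.
Proof.
rewrite /even_mode le_eqVlt => /predU1P[<-|t0].
  by rewrite H0_eta scaleNr addNr.
by rewrite H_eta ?gt_eqF ?addr0.
Qed.

(** A mode is moved to the right through the raising modes that created the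
    vector.  Each commutator is again a mode, or a scalar, of the same total
    degree and parity, and on [eta] itself every mode that does not raise
    vanishes. *)
Lemma twisted_space_modes r b x : twisted_space r b x -> forall t : int,
  [/\ twisted_space (r - (t%:~R - 2%:R^-1)) b (odd_plus t x),
      twisted_space (r - (t%:~R - 2%:R^-1)) (~~ b) (odd_minus t x)
    & twisted_space (r - t%:~R) (~~ b) (even_mode t x)].
Proof.
elim=> {r b x} [r b|r b c x y _ IHx _ IHy||r b u x u0 Tx IH|r b u x u0 Tx IH|r b u x u0 Tx IH] t.
- by rewrite !linear0; split; constructor.
- have [? ? ?] := IHx t; have [? ? ?] := IHy t.
  by rewrite !linearP; split; apply: TwistedLinear.
- split.
  + have [t0|t1] := lerP t 0; first by apply: TwistedOddPlus => //; constructor.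
    by rewrite odd_plus_eta; [constructor|lia].
  + have [t0|t1] := lerP t 0; first by apply: (TwistedOddMinus t0); constructor.
    by rewrite odd_minus_eta; [constructor|lia].
  + have [t0|t1] := ltrP t 0; first by apply: (TwistedEven t0); constructor.
    by rewrite even_mode_eta //; constructor.
- have [Tp Tm Te] := IH t; split.
  + rewrite odd_plus_odd_plus; apply: twisted_spaceD.
      by apply: (twisted_space_cast (TwistedOddPlus u0 Tp)) => //; ring.
    case: eqP => [tu|_]; last by constructor.
    apply/twisted_spaceZ/(twisted_space_cast Tx) => //.
    by rewrite (_ : u = 1 - t) ?rmorphB /=; [field|lia].
  + have [_ _ Tc] := IH (u + t - 1).
    have -> : odd_minus t (odd_plus u x)
        = odd_plus u (odd_minus t x) - 2%:R *: even_mode (u + t - 1) x.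
      by rewrite odd_plus_odd_minus addrK.
    apply: twisted_spaceB; last apply: twisted_spaceZ.
      by apply: (twisted_space_cast (TwistedOddPlus u0 Tm)) => //; ring.
    by apply: (twisted_space_cast Tc) => //; rewrite rmorphB rmorphD /=; field.
  + have [_ Tc _] := IH (t + u).
    rewrite even_mode_odd_plus; apply: twisted_spaceB; last apply: twisted_spaceZ.
      by apply: (twisted_space_cast (TwistedOddPlus u0 Te)) => //; ring.
    by apply: (twisted_space_cast Tc) => //; rewrite rmorphD /=; field.
- have [Tp Tm Te] := IH t; split.
  + have [_ _ Tc] := IH (t + u - 1).
    rewrite odd_plus_odd_minus; apply: twisted_spaceD; last apply: twisted_spaceZ.
      by apply: (twisted_space_cast (TwistedOddMinus u0 Tp)) => //; ring.
    by apply: (twisted_space_cast Tc) => //; rewrite rmorphB rmorphD /=; field.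
  + rewrite odd_minus_odd_minus; apply: twisted_spaceD.
      by apply: (twisted_space_cast (TwistedOddMinus u0 Tm)) => //; ring.
    case: eqP => [tu|_]; last by constructor.
    apply/twisted_spaceZ/(twisted_space_cast Tx); last by rewrite negbK.
    by rewrite (_ : u = 1 - t) ?rmorphB /=; [field|lia].
  + have [Tc _ _] := IH (t + u).
    rewrite even_mode_odd_minus; apply: twisted_spaceB; last apply: twisted_spaceZ.
      by apply: (twisted_space_cast (TwistedOddMinus u0 Te)) => //; ring.
    by apply: (twisted_space_cast Tc); rewrite ?negbK // rmorphD /=; field.
have [Tp Tm Te] := IH t; split.
- have [_ Tc _] := IH (u + t).
  have -> : odd_plus t (even_mode u x)
      = even_mode u (odd_plus t x) + 2%:R *: odd_minus (u + t) x.
    by rewrite even_mode_odd_plus subrK.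
  apply: twisted_spaceD; last apply: twisted_spaceZ.
    by apply: (twisted_space_cast (TwistedEven u0 Tp)) => //; ring.
  by apply: (twisted_space_cast Tc) => //; rewrite rmorphD /=; field.
- have [Tc _ _] := IH (u + t).
  have -> : odd_minus t (even_mode u x)
      = even_mode u (odd_minus t x) + 2%:R *: odd_plus (u + t) x.
    by rewrite even_mode_odd_minus subrK.
  apply: twisted_spaceD; last apply: twisted_spaceZ.
    by apply: (twisted_space_cast (TwistedEven u0 Tm)) => //; ring.
  by apply: (twisted_space_cast Tc); rewrite ?negbK // rmorphD /=; field.
rewrite even_mode_even_mode; apply: twisted_spaceD.
  by apply: (twisted_space_cast (TwistedEven u0 Te)) => //; ring.
case: eqP => [tu|_]; last by constructor.
apply/twisted_spaceZ/(twisted_space_cast Tx); last by rewrite negbK.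
by rewrite (_ : u = - t) ?rmorphN /=; [ring|lia].
Qed.

(** The smallest raising steps have size $1/2$ and are $h_{-1/2}$, even, and
    $(e-f)_{-1/2}$, odd.  Since degree $0$ is the even line of [eta], an odd
    vector of degree $1/2$ can only come from the second. *)
Lemma twisted_space_low r b x : twisted_space r b x ->
  [/\ r < 2%:R^-1 -> exists c, x = c *: eta,
      r < 2%:R^-1 -> (r != 0) || b -> x = 0
    & r = 2%:R^-1 -> b -> exists c, x = c *: odd_minus 0 eta].
Proof.
elim=> {r b x} [r b|r b c x y _ [IHx1 IHx2 IHx3] _ [IHy1 IHy2 IHy3]||
  r b t x t0 _ [_ IH _]|r b t x t0 _ [IH1 IH _]|r b t x t0 _ [_ IH _]].
- by split=> [_|//|_ _]; exists 0; rewrite scale0r.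
- split=> [lt|lt h|rE bE].
  + have [cx ->] := IHx1 lt; have [cy ->] := IHy1 lt.
    by exists (c * cx + cy); rewrite scalerDl scalerA.
  + by rewrite IHx2 ?IHy2 ?scaler0 ?addr0.
  have [cx ->] := IHx3 rE bE; have [cy ->] := IHy3 rE bE.
  by exists (c * cx + cy); rewrite scalerDl scalerA.
- by split=> // _; exists 1; rewrite scale1r.
- have tq : t%:~R <= 0 :> rat by rewrite lerz0.
  have x0 : r < 0 -> x = 0 by move=> r0; apply: IH; [lra|rewrite (lt_eqF r0)].
  split=> [lt|lt _|rE bE]; last by exists 0; rewrite scale0r IH ?linear0 ?bE ?orbT //; lra.
    by exists 0; rewrite x0 ?linear0 ?scale0r //; lra.
  by rewrite x0 ?linear0 //; lra.
- have tq : t%:~R <= 0 :> rat by rewrite lerz0.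
  have x0 : r < 0 -> x = 0 by move=> r0; apply: IH; [lra|rewrite (lt_eqF r0)].
  split=> [lt|lt _|rE bE].
  + by exists 0; rewrite x0 ?linear0 ?scale0r //; lra.
  + by rewrite x0 ?linear0 //; lra.
  have [tE|tn] := eqVneq t 0.
    have [c ->] : exists c, x = c *: eta by apply: IH1; lra.
    by exists c; rewrite tE linearZ.
  have tq1 : t%:~R <= -1 :> rat.
    by rewrite -(rmorphN1 (intr : int -> rat)) ler_int; lia.
  by exists 0; rewrite x0 ?linear0 ?scale0r //; lra.
have tq : t%:~R <= -1 :> rat by rewrite -(rmorphN1 (intr : int -> rat)) ler_int; lia.
have x0 : r < 0 -> x = 0 by move=> r0; apply: IH; [lra|rewrite (lt_eqF r0)].
split=> [lt|lt _|rE bE]; last by exists 0; rewrite x0 ?linear0 ?scale0r //; lra.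
  by exists 0; rewrite x0 ?linear0 ?scale0r //; lra.
by rewrite x0 ?linear0 //; lra.
Qed.

(** $[(e-f)_{1/2}, (e-f)_{-1/2}] = (e-f|e-f)k/2 = -k$. *)
Lemma odd_minus_lowering : odd_minus 1 (odd_minus 0 eta) = - k%:R *: eta.
Proof.
rewrite odd_minus_odd_minus odd_minus_eta // linear0 add0r.
by rewrite sub0r rmorphN1 mulN1r.
Qed.

End TwistedFock.

(** * Parity of the modes of the algebra *)
Section RotatedGenerators.
Variables (C : numFieldType) (k : nat) (V : vertexAlgebra C) (h e f : V).
Hypothesis HV : is_Lk0 k h e f.
Variable M : vaModule V.

Definition rotE : V := 2%:R^-1 *: (h - e + f).
Definition rotF : V := 2%:R^-1 *: (h + e - f).

Lemma rotE_modeE n u : va_mode rotE n u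
  = 2%:R^-1 *: (va_mode h n u - va_mode e n u + va_mode f n u).
Proof. by rewrite va_modeZl !va_modeDl va_modeNl. Qed.

Lemma rotF_modeE n u : va_mode rotF n u
  = 2%:R^-1 *: (va_mode h n u + va_mode e n u - va_mode f n u).
Proof. by rewrite va_modeZl !va_modeDl va_modeNl. Qed.

Let a := h'' e f.
Let omega := omega_aff k h e f.

Lemma affine_rotated : affine_sl2_action k (va_mode (e + f)) (va_mode rotE) (va_mode rotF).
Proof.
have := @affine_rotation C k V (va_mode h) (va_mode e) (va_mode f) (Lk0_affine HV).
rewrite (_ : va_mode (e + f) = fun n w => va_mode e n w + va_mode f n w); last first.
  by apply/funext => n; apply/funext => w; rewrite va_modeDl.
rewrite (_ : va_mode rotE = fun n w =>
    2%:R^-1 *: (va_mode h n w - va_mode e n w + va_mode f n w)); last first.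
  by apply/funext => n; apply/funext => w; rewrite rotE_modeE.
rewrite (_ : va_mode rotF = fun n w =>
    2%:R^-1 *: (va_mode h n w + va_mode e n w - va_mode f n w)) //.
by apply/funext => n; apply/funext => w; rewrite rotF_modeE.
Qed.

Lemma h''_modeE n u : va_mode a n u = 4%:R^-1 *: va_mode (e + f) n u.
Proof. exact: va_modeZl. Qed.

Lemma h''_commute (m n : nat) u :
  va_mode a m%:Z (va_mode a n%:Z u) = va_mode a n%:Z (va_mode a m%:Z u).
Proof.
rewrite !h''_modeE !linearZ /=; do 2 congr (_ *: _).
apply/eqP; rewrite -subr_eq0 (aff_hh affine_rotated).
case: (m%:Z + n%:Z =P 0) => [mn|_]; last by rewrite eqxx.
by rewrite (_ : m = 0%N) ?mulr0 ?mul0r ?scale0r ?eqxx //; lia.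
Qed.

Lemma h''_zero_commute (n : int) u :
  va_mode a 0 (va_mode a n u) = va_mode a n (va_mode a 0 u).
Proof.
rewrite !h''_modeE !linearZ /=; do 2 congr (_ *: _).
apply/eqP; rewrite -subr_eq0 (aff_hh affine_rotated) mulr0 mul0r scale0r.
by case: ifP; rewrite eqxx.
Qed.

Lemma h''_rotE (m n : int) u : va_mode a m (va_mode rotE n u)
  = va_mode rotE n (va_mode a m u) + 2%:R^-1 *: va_mode rotE (n + m) u.
Proof.
have /eqP := aff_he affine_rotated m n u; rewrite subr_eq => /eqP com.
by rewrite !h''_modeE linearZ /= com [m + n]addrC; module_eq C; field.
Qed.

Lemma h''_rotF (m n : int) u : va_mode a m (va_mode rotF n u)
  = va_mode rotF n (va_mode a m u) + - 2%:R^-1 *: va_mode rotF (n + m) u.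
Proof.
have /eqP := aff_hf affine_rotated m n u; rewrite subr_eq => /eqP com.
by rewrite !h''_modeE linearZ /= com [m + n]addrC; module_eq C; field.
Qed.

Lemma weight_h'' n u : va_mode omega 1 (va_mode a n u)
  = va_mode a n (va_mode omega 1 u) - n%:~R *: va_mode a n u.
Proof.
rewrite !h''_modeE !va_modeDl linearZ linearD /= (weight_e HV) (weight_f HV).
by module_eq C; ring.
Qed.

Lemma weight_rotE n u : va_mode omega 1 (va_mode rotE n u)
  = va_mode rotE n (va_mode omega 1 u) - n%:~R *: va_mode rotE n u.
Proof.
rewrite !rotE_modeE linearZ !linearD linearN /= ?linearZ /=.
by rewrite (weight_h HV) (weight_e HV) (weight_f HV); module_eq C; ring.
Qed.

Lemma weight_rotF n u : va_mode omega 1 (va_mode rotF n u)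
  = va_mode rotF n (va_mode omega 1 u) - n%:~R *: va_mode rotF n u.
Proof.
rewrite !rotF_modeE linearZ !linearD linearN /= ?linearZ /=.
by rewrite (weight_h HV) (weight_e HV) (weight_f HV); module_eq C; ring.
Qed.

Lemma weight_bounded : exists n0 : int, forall (n : int) (u : V),
  n < n0 -> weight_vector omega n u -> u = 0.
Proof. exact: voa_lower_bound (Lk0_voa HV). Qed.

Lemma bihomogeneousZ i (c : C) (x : V) :
  bihomogeneous omega a i x -> bihomogeneous omega a i (c *: x).
Proof.
by move=> [wx ax]; split; rewrite /weight_vector linearZ /= (wx, ax) !scalerA mulrC.
Qed.

Lemma rotated_sum : [/\ h = rotE + rotF, e - f = rotF - rotE,
  e = 2%:R^-1 *: ((e + f) + (rotF - rotE)) & f = 2%:R^-1 *: ((e + f) + (rotE - rotF))].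
Proof. by rewrite /rotE /rotF; split; module_eq C; field. Qed.

(** The modes of the rotated generators shift the weight and the
    $h''(0)$-eigenvalue. *)
Lemma all_bihomogeneous u : graded_sum (bihomogeneous omega a) u.
Proof.
apply: (generated_graded_sum HV) => [i c x||[d t] n x hx]; first exact: bihomogeneousZ.
  exact: graded_sum1 (bihomogeneous_vacuum omega a).
pose gZ := graded_sumZ bihomogeneousZ.
have gE : graded_sum (bihomogeneous omega a) (va_mode rotE n x).
  apply: (@graded_sum1 _ _ _ _ (d - n, t + 2%:R^-1)).
  by apply: bihomogeneous_mode hx => *; [exact: h''_rotE|exact: weight_rotE].
have gF : graded_sum (bihomogeneous omega a) (va_mode rotF n x).
  apply: (@graded_sum1 _ _ _ _ (d - n, t - 2%:R^-1)).
  by apply: bihomogeneous_mode hx => *; [exact: h''_rotF|exact: weight_rotF].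
have gH : graded_sum (bihomogeneous omega a) (va_mode (e + f) n x).
  rewrite (_ : e + f = 4%:R *: a); last first.
    by rewrite scalerA mulfV ?scale1r // pnatr_eq0.
  rewrite va_modeZl; apply: gZ; apply: (@graded_sum1 _ _ _ _ (d - n, t)).
  have [/= wx ax] := hx; split; rewrite /weight_vector /=.
    by rewrite weight_h'' wx linearZ /= -scalerBl rmorphB.
  by rewrite h''_zero_commute ax linearZ.
have [hE _ eE fE] := rotated_sum; split.
- by rewrite hE va_modeDl; exact: graded_sumD.
- rewrite eE va_modeZl va_modeDl (va_modeDl rotF) va_modeNl.
  apply/gZ/graded_sumD/graded_sumD; [exact: gH|exact: gF|].
  by rewrite -scaleN1r; exact: gZ.
rewrite fE va_modeZl va_modeDl (va_modeDl rotE) va_modeNl.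
apply/gZ/graded_sumD/graded_sumD; [exact: gH|exact: gE|].
by rewrite -scaleN1r; exact: gZ.
Qed.

Let commutes := h''_commute.
Let lowers := weight_h''.
Let bounded := weight_bounded.
Let decomposes := all_bihomogeneous.

Fact sigma_mode_is_linear n (x : M) : linear (fun u => sigma_mode e f u n x).
Proof. exact: (twisted_mode_linear commutes lowers bounded decomposes). Qed.

Fact sigma_mode_is_linear_r u n : linear (sigma_mode e f u n : M -> M).
Proof. exact: (twisted_mode_linear_r commutes lowers bounded decomposes). Qed.

Lemma sigma_modeP c u u' n (x : M) :
  sigma_mode e f (c *: u + u') n x = c *: sigma_mode e f u n x + sigma_mode e f u' n x.
Proof. exact: sigma_mode_is_linear. Qed.

Lemma sigma_mode0 n (x : M) : sigma_mode e f 0 n x = 0.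
Proof. by have := sigma_modeP (-1) 0 0 n x; rewrite scaler0 addr0 scaleN1r addNr. Qed.

Lemma sigma_mode_rotE n (z : int) (x : M) :
  z%:~R = ratr n + 2%:R^-1 :> C -> sigma_mode e f rotE n x = mod_mode rotE z x.
Proof.
apply: (twisted_mode_generator commutes lowers) => *; [exact: h''_rotE|exact: weight_rotE].
Qed.

Lemma sigma_mode_rotF n (z : int) (x : M) :
  z%:~R = ratr n - 2%:R^-1 :> C -> sigma_mode e f rotF n x = mod_mode rotF z x.
Proof.
apply: (twisted_mode_generator commutes lowers) => *; [exact: h''_rotF|exact: weight_rotF].
Qed.

(** The twisted Borcherds identity at exponent $1/2$ for $A$ with half-integral
    modes $A_{t-1/2} = $ [op t].  This normalization is common to $E$ and $F$
    although their untwisted indices differ, so the identity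
    passes to the combinations $h$ and $e - f$, which have a parity. *)
Definition twisted_field (A : V) (op : int -> M -> M) :=
  forall (u : V) (x : M) (l : int) (n : rat),
  exists N0 : nat, forall N, (N0 <= N)%N ->
  \sum_(j < N) gbinom (2%:R^-1 : C) j *:
     sigma_mode e f (va_mode A (l + j%:Z) u) (2%:R^-1 + n - j%:R) x
  = \sum_(j < N) ((-1) ^+ j * gbinom (l%:~R : C) j) *:
     (op (l + 1 - j%:Z) (sigma_mode e f u (n + j%:R) x)
      - (-1) ^ l *: sigma_mode e f u (l%:~R + n - j%:R) (op (1 + j%:Z) x)).

Lemma twisted_field_rotE : twisted_field rotE (mod_mode rotE).
Proof.
move=> u x l n; apply: (twisted_borcherds_all commutes lowers bounded decomposes (m' := 1));
  by [exact: h''_rotE|exact: weight_rotE|field].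
Qed.

Lemma twisted_field_rotF : twisted_field rotF (fun t => mod_mode rotF (t - 1)).
Proof.
move=> u x l n.
have [N0 hN] : exists N0 : nat, forall N, (N0 <= N)%N ->
  \sum_(j < N) gbinom (2%:R^-1 : C) j *:
     sigma_mode e f (va_mode rotF (l + j%:Z) u) (2%:R^-1 + n - j%:R) x
  = \sum_(j < N) ((-1) ^+ j * gbinom (l%:~R : C) j) *:
     (mod_mode rotF (l + 0 - j%:Z) (sigma_mode e f u (n + j%:R) x)
      - (-1) ^ l *: sigma_mode e f u (l%:~R + n - j%:R) (mod_mode rotF (0 + j%:Z) x)).
  apply: (twisted_borcherds_all commutes lowers bounded decomposes (m' := 0));
    by [exact: h''_rotF|exact: weight_rotF|rewrite subrr].
exists N0 => N /hN ->; apply: eq_bigr => j _.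
by congr (_ *: (mod_mode _ _ _ - _ *: sigma_mode _ _ _ _ (mod_mode _ _ _))); lia.
Qed.

Lemma twisted_field_linear A A' op op' op'' c :
  twisted_field A op -> twisted_field A' op' ->
  (forall t x, op'' t x = op t x + c *: op' t x) -> twisted_field (A + c *: A') op''.
Proof.
move=> hA hA' opE u x l n; have [N1 h1] := hA u x l n; have [N2 h2] := hA' u x l n.
exists (N1 + N2)%N => N leN.
transitivity (\sum_(j < N) gbinom (2%:R^-1 : C) j *:
     sigma_mode e f (va_mode A (l + j%:Z) u) (2%:R^-1 + n - j%:R) x
   + c *: \sum_(j < N) gbinom (2%:R^-1 : C) j *:
     sigma_mode e f (va_mode A' (l + j%:Z) u) (2%:R^-1 + n - j%:R) x).
  rewrite scaler_sumr -big_split; apply: eq_bigr => j _ /=.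
  rewrite va_modeDl (va_modeZl c) [va_mode A _ _ + _]addrC sigma_modeP.
  by module_eq C; ring.
rewrite h1 ?h2; [|lia|lia]; rewrite scaler_sumr -big_split; apply: eq_bigr => j _ /=.
rewrite !opE (addrC (op (1 + j%:Z) x)) sigma_mode_is_linear_r.
by module_eq C; ring.
Qed.

Let Hm (n : int) : {linear M -> M} := mod_mode (e + f) n.
Let Em (n : int) : {linear M -> M} := mod_mode rotE n.
Let Fm (n : int) : {linear M -> M} := mod_mode rotF n.

Lemma twisted_field_h : twisted_field h (odd_plus Em Fm).
Proof.
have [-> _ _ _] := rotated_sum; rewrite -[X in _ + X]scale1r.
apply: twisted_field_linear twisted_field_rotE twisted_field_rotF _ => t x.
by rewrite scale1r.
Qed.

Lemma twisted_field_ef : twisted_field (e - f) (odd_minus Em Fm).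
Proof.
have [_ -> _ _] := rotated_sum; rewrite -[X in _ + X]scaleN1r.
apply: twisted_field_linear twisted_field_rotF twisted_field_rotE _ => t x.
by rewrite scaleN1r.
Qed.

Variable eta : M.
Hypothesis E_eta : forall t : int, 1 <= t -> mod_mode rotE t eta = 0.
Hypothesis F_eta : forall t : int, 0 <= t -> mod_mode rotF t eta = 0.
Hypothesis H_eta : forall t : int, 1 <= t -> mod_mode (e + f) t eta = 0.
Hypothesis H0_eta : mod_mode (e + f) 0 eta = - (2%:R^-1 * k%:R) *: eta.

Let act_M : affine_sl2_action k Hm Em Fm := affine_module M affine_rotated.
Let Tw := twisted_space k Hm Em Fm eta.

(** All twisted modes of $u$ are homogeneous for degree and parity, as those of
    a vector of weight $d$ and parity $b$ should be. *)
Definition parity_graded (d : int) (b : bool) (u : V) :=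
  forall n r c x, Tw r c x -> Tw (r - (n - d%:~R + 1)) (b (+) c) (sigma_mode e f u n x).

Lemma parity_graded_linear d b c u u' :
  parity_graded d b u -> parity_graded d b u' -> parity_graded d b (c *: u + u').
Proof.
by move=> hu hu' n r b' x Tx; rewrite sigma_modeP; apply: TwistedLinear; [apply: hu|apply: hu'].
Qed.

Lemma parity_graded0 d b : parity_graded d b 0.
Proof. by move=> n r b' x Tx; rewrite sigma_mode0; constructor. Qed.

Lemma parity_gradedZ d b c u : parity_graded d b u -> parity_graded d b (c *: u).
Proof.
by move=> hu; rewrite -[_ *: _]addr0; apply: parity_graded_linear => //; apply: parity_graded0.
Qed.

Lemma parity_gradedD d b u u' :
  parity_graded d b u -> parity_graded d b u' -> parity_graded d b (u + u').
Proof. by move=> hu hu'; rewrite -[u]scale1r; apply: parity_graded_linear. Qed.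

Lemma parity_gradedB d b u u' :
  parity_graded d b u -> parity_graded d b u' -> parity_graded d b (u - u').
Proof. by move=> hu hu'; rewrite addrC -scaleN1r; apply: parity_graded_linear. Qed.

Lemma parity_graded_vacuum : parity_graded 0 false (vacuum V).
Proof.
move=> n r c x Tx; rewrite /sigma_mode (twisted_mode_vacuum commutes lowers).
by case: eqP => [->|_]; [apply: twisted_space_cast Tx _ _ => //; ring|constructor].
Qed.

(** In the twisted Borcherds identity the term $j = 0$ of the left-hand side is a
    mode of $A(l)u$; the other terms involve $A(l+j)u$ with $j > 0$.  As
    $A(l)u = 0$ for large $l$, descending induction on $l$ applies. *)
Lemma parity_graded_mode (A : V) (op : int -> M -> M) (bA : bool) :
  twisted_field A op ->
  (forall r c x t, Tw r c x -> Tw (r - (t%:~R - 2%:R^-1)) (bA (+) c) (op t x)) ->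
  forall d b u l, parity_graded d b u -> parity_graded (d - l) (bA (+) b) (va_mode A l u).
Proof.
move=> fieldA opT d b u l hu; have [N hN] := va_mode_truncated A u l.
(* $A(l')u = 0$ for $l' \ge l + N$; [i] counts the steps down from there. *)
suff main i l' : l + N%:Z - i%:Z <= l' -> parity_graded (d - l') (bA (+) b) (va_mode A l' u).
  by apply: (main N); rewrite addrK.
elim: i l' => [|i IH] l' lel'.
  rewrite (_ : l' = l + `|l' - l|%N%:Z); last by lia.
  by rewrite hN; [apply: parity_graded0|lia].
move=> n r c x Tx; have [N0 hN0] := fieldA u x l' (n - 2%:R^-1).
have := hN0 N0.+1 (leqnSn _); rewrite big_ord_recl /= gbinom0 scale1r addr0 subr0.
rewrite [2%:R^-1 + _]addrC subrK => eqA.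
rewrite -[sigma_mode e f (va_mode A l' u) n x](addrK
  (\sum_(i0 < N0) gbinom (2%:R^-1 : C) (bump 0 i0) *:
    sigma_mode e f (va_mode A (l' + (bump 0 i0)%:Z) u) (n - (bump 0 i0)%:R) x)) eqA.
apply: twisted_spaceB; apply: twisted_space_sum => j _; apply: twisted_spaceZ.
  apply: twisted_spaceB; last apply: twisted_spaceZ.
    apply: (twisted_space_cast (opT _ _ _ _ (hu _ _ _ _ Tx))); last by rewrite addbA.
    by rewrite !rmorphB !rmorphD /= -pmulrn; field.
  apply: (twisted_space_cast (hu _ _ _ _ (opT _ _ _ _ Tx))); last by rewrite addbA [b (+) _]addbC.
  by rewrite rmorphB rmorphD /= -pmulrn; field.
have le1 : l' + (bump 0 j)%:Z >= l + N%:Z - i%:Z by rewrite /bump; lia.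
apply: (twisted_space_cast (IH _ le1 _ _ _ _ Tx)) => //.
by rewrite !rmorphB !rmorphD /= -pmulrn; field.
Qed.

Let op_plus r c x t : Tw r c x -> Tw (r - (t%:~R - 2%:R^-1)) (false (+) c) (odd_plus Em Fm t x).
Proof. by move=> Tx; have [] := twisted_space_modes act_M E_eta F_eta H_eta H0_eta Tx t. Qed.

Let op_minus r c x t : Tw r c x -> Tw (r - (t%:~R - 2%:R^-1)) (true (+) c) (odd_minus Em Fm t x).
Proof. by move=> Tx; have [] := twisted_space_modes act_M E_eta F_eta H_eta H0_eta Tx t. Qed.

Lemma parity_graded_h d b u l : parity_graded d b u -> parity_graded (d - l) b (va_mode h l u).
Proof. exact: (parity_graded_mode twisted_field_h op_plus). Qed.

Lemma parity_graded_ef d b u l :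
  parity_graded d b u -> parity_graded (d - l) (~~ b) (va_mode (e - f) l u).
Proof. exact: (parity_graded_mode twisted_field_ef op_minus). Qed.

(** $2(e+f)(l) = [h(0), (e-f)(l)]$, so the integral modes need no Borcherds
    identity of their own. *)
Lemma parity_graded_sum d b u l :
  parity_graded d b u -> parity_graded (d - l) (~~ b) (va_mode (e + f) l u).
Proof.
move=> hu; have act := Lk0_affine HV.
have -> : va_mode (e + f) l u = 2%:R^-1 *: (va_mode h 0 (va_mode (e - f) l u)
     - va_mode (e - f) l (va_mode h 0 u)).
  rewrite !va_modeDl !va_modeNl [va_mode h 0 _]linearB /=.
  have /eqP := aff_he act 0 l u; rewrite subr_eq add0r => /eqP->.
  have /eqP := aff_hf act 0 l u; rewrite subr_eq add0r => /eqP->.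
  by module_eq C; field.
apply/parity_gradedZ/parity_gradedB.
  by rewrite -[d - l]subr0; apply/parity_graded_h/parity_graded_ef.
by apply: parity_graded_ef; rewrite -[d]subr0; apply: parity_graded_h.
Qed.

Lemma parity_graded_e d b u l :
  parity_graded d b u -> parity_graded (d - l) (~~ b) (va_mode e l u).
Proof.
move=> hu; have -> : va_mode e l u
    = 2%:R^-1 *: (va_mode (e + f) l u + va_mode (e - f) l u).
  by rewrite !va_modeDl va_modeNl; module_eq C; field.
by apply/parity_gradedZ/parity_gradedD; [apply: parity_graded_sum|apply: parity_graded_ef].
Qed.

Lemma parity_graded_f d b u l :
  parity_graded d b u -> parity_graded (d - l) (~~ b) (va_mode f l u).
Proof.
move=> hu; have -> : va_mode f l u
    = 2%:R^-1 *: (va_mode (e + f) l u - va_mode (e - f) l u).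
  by rewrite !va_modeDl va_modeNl; module_eq C; field.
by apply/parity_gradedZ/parity_gradedB; [apply: parity_graded_sum|apply: parity_graded_ef].
Qed.

(** The charge of a monomial in modes is its number of factors $e$ minus its
    number of factors $f$; its parity is that of the number of odd factors. *)
Definition charge_graded (i : int * int) (u : V) :=
  [/\ va_mode omega 1 u = i.1%:~R *: u, va_mode h 0 u = (2 * i.2)%:~R *: u
    & parity_graded i.1 (odd `|i.2|%N) u].

Lemma all_charge_graded u : graded_sum charge_graded u.
Proof.
have act := Lk0_affine HV.
apply: (generated_graded_sum HV) => [i c x [wx hx px]||[d q] n x [/= wx hx px]].
- by split; [rewrite linearZ /= wx|rewrite linearZ /= hx|exact: parity_gradedZ];
    rewrite !scalerA mulrC.
- apply: (@graded_sum1 _ _ _ _ (0, 0)); split; last exact: parity_graded_vacuum.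
    by rewrite va_creation0 // scale0r.
  by rewrite va_creation0 // mulr0 scale0r.
split.
- apply: (@graded_sum1 _ _ _ _ (d - n, q)); split => /=; last exact: parity_graded_h.
    by rewrite (weight_h HV) wx linearZ /= -scalerBl rmorphB.
  have /eqP := aff_hh act 0 n x; rewrite mulr0 mul0r scale0r if_same subr_eq0 => /eqP->.
  by rewrite hx linearZ.
- apply: (@graded_sum1 _ _ _ _ (d - n, q + 1)); split => /=.
  + by rewrite (weight_e HV) wx linearZ /= -scalerBl rmorphB.
  + have /eqP := aff_he act 0 n x; rewrite subr_eq add0r => /eqP->.
    by rewrite hx linearZ /= -scalerDl mulrDr rmorphD /= addrC.
  by rewrite (_ : odd _ = ~~ odd `|q|%N); [exact: parity_graded_e|lia].
apply: (@graded_sum1 _ _ _ _ (d - n, q - 1)); split => /=.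
- by rewrite (weight_f HV) wx linearZ /= -scalerBl rmorphB.
- have /eqP := aff_hf act 0 n x; rewrite subr_eq add0r => /eqP->.
  by rewrite hx [va_mode f n (_ *: _)]linearZ /= addrC -scalerBl mulrBr rmorphB.
by rewrite (_ : odd _ = ~~ odd `|q|%N); [exact: parity_graded_f|lia].
Qed.

(** Vectors of $K_0$ are sums of monomials of charge zero, hence even. *)
Lemma K0_parity_graded u (d : int) : (0 < k)%N ->
  K0 h u -> weight_vector (omega_K0 k h e f) d u -> parity_graded d false u.
Proof.
move=> k0 Ku; rewrite /weight_vector (K0_weight HV k0 Ku) => wu.
have [l [hl uE]] := all_charge_graded u.
have u1 : u = \sum_(p <- l | p.1.1 == d) p.2.
  have := @eigenlist_eigenvector C V (va_mode omega 1) [seq (p.1.1%:~R, p.2) | p <- l] d%:~R u.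
  rewrite !big_map /= => -> //; first by apply: eq_bigl => p; rewrite eqr_int.
  by move=> _ /mapP[p /hl[wp _ _] ->].
have u2 : u = \sum_(p <- l | (p.1.1 == d) && (p.1.2 == 0)) p.2.
  have := @eigenlist_eigenvector C V (va_mode h 0)
    [seq ((2 * p.1.2)%:~R, p.2) | p <- l & p.1.1 == d] 0 u.
  rewrite !big_map /= !big_filter_cond /= => -> //.
  - by apply: eq_bigl => p; rewrite -(rmorph0 (intr : int -> C)) eqr_int mulf_eq0.
  - by move=> _ /mapP[p lp ->]; move: lp; rewrite mem_filter => /andP[_ /hl[]].
  - by rewrite Ku // scale0r.
  - by rewrite {1}u1; apply: eq_bigl => p; rewrite andbT.
rewrite u2 big_seq_cond; apply: big_ind.
- exact: parity_graded0.
- by move=> x y; apply: parity_gradedD.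
by move=> p /and3P[/hl[_ _ hp] /eqP dE /eqP qE]; move: hp; rewrite dE qE.
Qed.

Lemma omega_K0_parity_graded : parity_graded 2 false (omega_K0 k h e f).
Proof.
have v0 := parity_graded_vacuum.
have h1 : parity_graded 1 false h.
  by rewrite -[h]va_creation; exact: (parity_graded_h (-1) v0).
have f1 : parity_graded 1 true f.
  by rewrite -[f]va_creation; exact: (parity_graded_f (-1) v0).
rewrite /omega_K0; apply/parity_gradedZ/parity_gradedD; last first.
  by apply: parity_gradedZ; exact: (parity_graded_e (-1) f1).
rewrite -scaleN1r; apply: parity_gradedB.
  by apply/parity_gradedZ/parity_gradedZ; exact: (parity_graded_h (-2) v0).
exact: (parity_graded_h (-1) h1).
Qed.

Lemma sigma_mode_ef : sigma_mode e f (e - f) (- (1 / 2)) eta = odd_minus Em Fm 0 eta.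
Proof.
have [_ -> _ _] := rotated_sum.
rewrite addrC -scaleN1r sigma_modeP scaleN1r addrC /odd_minus.
have half : ratr (- (1 / 2)) = - 2%:R^-1 :> C.
  by rewrite rmorphN div1r fmorphV /= ratr_nat.
rewrite (@sigma_mode_rotF _ (-1)) ?(@sigma_mode_rotE _ 0) ?half //.
  by rewrite addNr.
by rewrite rmorphN1; field.
Qed.

Lemma lowest_weight_pair : (0 < k)%N -> eta <> 0 ->
  let w := sigma_mode e f (e - f) (- (1 / 2)) eta in
  [/\ lowest_weight_vector k h e f eta, lowest_weight_vector k h e f w
    & ~ exists c : C, w = c *: eta].
Proof.
move=> k0 eta0 w.
have Teta : Tw 0 false eta by constructor.
have Tw_w : Tw 2%:R^-1 true w.
  rewrite /w sigma_mode_ef; apply: twisted_space_cast (TwistedOddMinus _ Teta) _ _ => //.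
have w_indep c : w <> c *: eta.
  move=> wE; apply: eta0.
  have := odd_minus_lowering act_M E_eta F_eta; rewrite -sigma_mode_ef -/w wE linearZ /=.
  rewrite odd_minus_eta // scaler0 => /esym/eqP.
  by rewrite scaler_eq0 oppr_eq0 pnatr_eq0 eqn0Ngt k0 => /eqP.
split; last by case.
- split=> //.
    have := omega_K0_parity_graded 1 Teta; rewrite (_ : 0 - _ = 0); last by field.
    by case/twisted_space_low => + _ _; apply; rewrite invr_gt0.
  move=> u d m Ku wu ltm.
  have [_ low _] := twisted_space_low (K0_parity_graded k0 Ku wu m Teta).
  have neg : 0 - (m - d%:~R + 1) < 0 by lra.
  by apply: low; [lra|rewrite lt_eqF].
split; first by move=> w0; apply: (w_indep 0); rewrite scale0r.
  have := omega_K0_parity_graded 1 Tw_w; rewrite (_ : 2%:R^-1 - _ = 2%:R^-1); last by field.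
  by case/twisted_space_low => _ _ /(_ erefl isT); rewrite -sigma_mode_ef.
move=> u d m Ku wu ltm.
have [_ low _] := twisted_space_low (K0_parity_graded k0 Ku wu m Tw_w).
by apply: low; [lra|rewrite orbT].
Qed.

End RotatedGenerators.

(** * The vector eta *)
Section LowestVector.
Variables (C : numFieldType) (k i : nat) (V : vertexAlgebra C) (h e f : V).
Variables (M : vaModule V) (v : nat -> M).
Hypothesis HM : is_Lki k h e f i v.

Let eta : M := \sum_(j < i.+1) (-1) ^+ j *: v j.

Lemma alternating_neq0 : eta <> 0.
Proof.
move=> eta0; have := Lki_free HM eta0 (leq0n i).
by rewrite expr0; apply/eqP; rewrite oner_neq0.
Qed.

Lemma alternating_positive (t : int) : 1 <= t ->
  [/\ mod_mode h t eta = 0, mod_mode e t eta = 0 & mod_mode f t eta = 0].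
Proof.
by move=> t1; split; rewrite linear_sum big1 // => j _; rewrite linearZ /=;
  have [h0 e0 f0] := Lki_pos HM (ltn_ord j : j <= i)%N t1; rewrite (h0, e0, f0) scaler0.
Qed.

Lemma alternating_h : mod_mode h 0 eta
  = \sum_(j < i.+1) ((-1) ^+ j * (i%:R - (2 * j)%:R)) *: v j.
Proof.
rewrite linear_sum; apply: eq_bigr => j _.
by rewrite linearZ /= (Lki_h HM) ?scalerA // -ltnS.
Qed.

Lemma alternating_e : mod_mode e 0 eta
  = \sum_(j < i.+1) (- (-1) ^+ j * (i%:R - j%:R)) *: v j.
Proof.
rewrite linear_sum big_ord_recl linearZ /= (Lki_e0 HM) scaler0 add0r.
rewrite [RHS]big_ord_recr /= subrr mulr0 scale0r addr0; apply: eq_bigr => j _.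
have ltj := ltn_ord j; rewrite linearZ /= /bump leq0n add1n (Lki_e HM) /=; last by lia.
rewrite scalerA exprS mulN1r (_ : i - j.+1 + 1 = i - j)%N; last by lia.
by rewrite natrB // ltnW.
Qed.

Lemma alternating_f : mod_mode f 0 eta
  = \sum_(j < i.+1) (- (-1) ^+ j * j%:R) *: v j.
Proof.
rewrite linear_sum big_ord_recr linearZ /= (Lki_fi HM) scaler0 addr0.
rewrite [RHS]big_ord_recl /= mulr0 scale0r add0r; apply: eq_bigr => j _.
rewrite linearZ /= (Lki_f HM) // /bump leq0n add1n scalerA exprS.
by rewrite mulN1r opprK.
Qed.

End LowestVector.
Theorem lemma3p10 (R : realType) (k : nat) (hk : (4 <= k)%N)
    (k_even : ~~ odd k)
    (V : vertexAlgebra R[i]) (h e f : V) (HV : is_Lk0 k h e f)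
    (M : vaModule V) (v : nat -> M) (HM : is_Lki k h e f k./2 v) :
  let eta : M := \sum_(j < (k./2).+1) (-1) ^+ j *: v j in
  let w : M := sigma_mode e f (e - f) (- (1 / 2)) eta in
  [/\ lowest_weight_vector k h e f eta,
      lowest_weight_vector k h e f w
    & ~ exists c : R[i], w = c *: eta].
Proof.
move=> eta; have k0 : (0 < k)%N by apply: leq_trans hk.
have rotE_eta t : mod_mode (rotE h e f) t eta
    = 2%:R^-1 *: (mod_mode h t eta - mod_mode e t eta + mod_mode f t eta).
  by rewrite modeZl !modeDl modeNl.
have rotF_eta t : mod_mode (rotF h e f) t eta
    = 2%:R^-1 *: (mod_mode h t eta + mod_mode e t eta - mod_mode f t eta).
  by rewrite modeZl !modeDl modeNl.
apply: (lowest_weight_pair HV) => //.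
- by move=> t /(alternating_positive HM)[h0 e0 f0]; rewrite rotE_eta h0 e0 f0 subr0 addr0 scaler0.
- move=> t; rewrite le_eqVlt => /predU1P[<-|t0]; last first.
    have [h0 e0 f0] := alternating_positive HM (t0 : 1 <= t).
    by rewrite rotF_eta h0 e0 f0 addr0 subr0 scaler0.
  rewrite rotF_eta (alternating_h HM) (alternating_e HM) (alternating_f HM).
  rewrite -big_split -sumrB big1 ?scaler0 // => j _ /=.
  rewrite -scalerDl -scalerBl natrM [X in X *: _](_ : _ = 0) ?scale0r //; ring.
- by move=> t /(alternating_positive HM)[h0 e0 f0]; rewrite modeDl e0 f0 addr0.
- rewrite modeDl (alternating_e HM) (alternating_f HM) scaler_sumr -big_split.
  apply: eq_bigr => j _ /=; rewrite -scalerDl scalerA; congr (_ *: _).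
  have -> : k%:R = 2%:R * (k./2)%:R :> R[i].
    by rewrite -natrM mul2n even_halfK.
  by field.
exact: alternating_neq0 HM.
Qed.
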